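(* For every integer $n\ge0$ and every $\lambda\in\mathbb{C}$ there are isomorphisms of algebras $$\mathcal{A}_\Lambda(n)\simeq\mathcal{C}(2n)\otimes\mathcal{A}_\Lambda\simeq\mathcal{M}_{2^n}(\mathcal{A}_\Lambda),\qquad \mathcal{A}_\lambda(n)\simeq\mathcal{C}(2n)\otimes\mathcal{A}_\lambda\simeq\mathcal{M}_{2^n}(\mathcal{A}_\lambda),$$ where $\mathcal{A}_\Lambda=\mathcal{A}_\Lambda(0)$, $\mathcal{A}_\lambda=\mathcal{A}_\lambda(0)$, and $\otimes$ is the ordinary (ungraded) tensor product over $\mathbb{C}$.
   Context: All algebras are unital associative over $\mathbb{C}$; $[a,b]_{\mathcal L}=ab-ba$. $\mathcal{C}(2n)$ is the Clifford algebra with generators $\omega_1,\dots,\omega_{2n}$ and relations $\omega_i\omega_j+\omega_j\omega_i=2\delta_{ij}$. For $\lambda\in\mathbb{C}$, $\mathcal{A}_\lambda(n)$ is the algebra with generators $\omega_1,\dots,\omega_{2n+1},E_+,E_-$ and relations $[E_+,E_-]_{\mathcal L}=-\frac14+i^n\lambda\,\omega_1\cdots\omega_{2n+1}$, $\omega_j\omega_k+\omega_k\omega_j=2\delta_{jk}$, $E_\pm\omega_j=-\omega_jE_\pm$ ($1\le j,k\le 2n+1$). $\mathcal{A}_\Lambda(n)$ is the algebra with generators $\omega_1,\dots,\omega_{2n+1},E_+,E_-,\Lambda$, with $\Lambda$ central and the same relations with $\lambda$ replaced by $\Lambda$. $\mathcal{M}_r(A)$ is the algebra of $r\times r$ matrices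 over $A$. *)

(* Defs.v *)
From HB Require Import structures.
From mathcomp Require Import all_boot all_order all_algebra finmap.
From mathcomp Require Import boolp reals.
From mathcomp Require Import complex.
From mathcomp.multinomials Require Import monalg.

Set Implicit Arguments.
Unset Strict Implicit.
Unset Printing Implicit Defensive.

Import GRing.Theory.
Local Open Scope ring_scope.

Reserved Notation "k • x" (at level 40, left associativity).
Reserved Notation "A ≃ B" (at level 70, no associativity).
Reserved Notation "A ⊗ B" (at level 40, left associativity).

(* Unital associative K-algebras.  The library's algType is built on          *)
(* nzRingType, i.e. it demands 1 != 0, but an algebra given by generators and *)
(* relations is not known to be nonzero beforehand.  The scaling is a         *)
(* separate operation, since HB does not accept a new join of pzRingType and  *)
(* lmodType; as a consequence the algebra of matrices over a K-algebra can    *)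
(* live on 'M[A]_r, whose library scaling *: is the one by elements of A.     *)
HB.mixin Record PzRing_isUAlg (K : fieldType) A of GRing.PzRing A := {
  uscale : K -> A -> A;
  uscaleA : forall k l x, uscale k (uscale l x) = uscale (k * l) x;
  uscale1 : forall x, uscale 1 x = x;
  uscaleDr : forall k x y, uscale k (x + y) = uscale k x + uscale k y;
  uscaleDl : forall k l x, uscale (k + l) x = uscale k x + uscale l x;
  uscaleAl : forall k x y, uscale k (x * y) = uscale k x * y;
  uscaleAr : forall k x y, uscale k (x * y) = x * uscale k y
}.

#[short(type="uAlgType")]
HB.structure Definition UAlg (K : fieldType) :=
  {A of GRing.PzRing A & PzRing_isUAlg K A}.

Notation "k • x" := (uscale k x) : ring_scope.

Definition alg_iso (K : fieldType) (A B : uAlgType K) : Prop :=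
  exists f : {rmorphism A -> B},
    (forall (k : K) (x : A), f (k • x) = k • f x) /\ bijective f.

Notation "A ≃ B" := (alg_iso A B) : type_scope.

Lemma uscaleB (K : fieldType) (A : uAlgType K) (k : K) (x y : A) :
  k • (x - y) = k • x - k • y.
Proof.
by apply: (addIr (k • y)); rewrite -uscaleDr !subrK.
Qed.

HB.mixin Record isTwoSided (A : pzRingType) (J : A -> bool) := {
  two_sidedMl : forall a x : A, x \in J -> a * x \in J;
  two_sidedMr : forall a x : A, x \in J -> x * a \in J
}.

#[short(type="twoSidedIdeal")]
HB.structure Definition TwoSidedIdeal (A : pzRingType) :=
  {J of isTwoSided A J & GRing.ZmodClosed A J}.

(* {quot J} carries a ring structure in the library only for commutative A.   *)
Definition quotAlg (K : fieldType) (A : uAlgType K) (J : twoSidedIdeal A) :=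
  Quotient.quot J.

Section QuotAlg.
Context (K : fieldType) (A : uAlgType K) (J : twoSidedIdeal A).
Local Notation Q := (quotAlg J).

HB.instance Definition _ := GRing.Zmodule.on Q.

Definition quot_pi (x : A) : Q := \pi_(Quotient.quot J)%qT x.
Definition quot_repr (q : Q) : A := repr (q : Quotient.quot J).

Lemma quot_piE x y : (quot_pi x == quot_pi y) = (x - y \in J).
Proof. exact/esym/Quotient.idealrBE. Qed.

Lemma quot_pi_eq x y : x - y \in J -> quot_pi x = quot_pi y.
Proof. by rewrite -quot_piE => /eqP. Qed.

Lemma quot_reprK q : quot_pi (quot_repr q) = q.
Proof. exact: reprK. Qed.

Lemma quot_repr_pi x : quot_repr (quot_pi x) - x \in J.
Proof. by rewrite -quot_piE quot_reprK. Qed.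

Lemma quot_ind (P : Q -> Prop) : (forall x, P (quot_pi x)) -> forall q, P q.
Proof. by move=> PP q; rewrite -[q]quot_reprK. Qed.

Lemma quot_piD x y : quot_pi (x + y) = quot_pi x + quot_pi y.
Proof. by rewrite /quot_pi Quotient.pi_add. Qed.

Definition quot_one : Q := quot_pi 1.
Definition quot_mul (p q : Q) : Q := quot_pi (quot_repr p * quot_repr q).
Definition quot_scale (k : K) (q : Q) : Q := quot_pi (k • quot_repr q).

Lemma two_sidedZ (k : K) x : x \in J -> k • x \in J.
Proof. by move=> xJ; rewrite -[x]mul1r uscaleAl; exact: two_sidedMl. Qed.

Lemma quot_mulE x y : quot_mul (quot_pi x) (quot_pi y) = quot_pi (x * y).
Proof.
apply: quot_pi_eq; set x' := quot_repr _; set y' := quot_repr _.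
have -> : x' * y' - x * y = (x' - x) * y' + x * (y' - y).
  by rewrite mulrBl mulrBr addrA subrK.
apply: rpredD; first exact/two_sidedMr/quot_repr_pi.
exact/two_sidedMl/quot_repr_pi.
Qed.

Lemma quot_scaleE k x : quot_scale k (quot_pi x) = quot_pi (k • x).
Proof.
apply: quot_pi_eq; rewrite -uscaleB; exact/two_sidedZ/quot_repr_pi.
Qed.

Fact quot_mulA : associative quot_mul.
Proof.
elim/quot_ind => x; elim/quot_ind => y; elim/quot_ind => z.
by rewrite !quot_mulE mulrA.
Qed.
Fact quot_mul1q : left_id quot_one quot_mul.
Proof. by elim/quot_ind => x; rewrite quot_mulE mul1r. Qed.
Fact quot_mulq1 : right_id quot_one quot_mul.
Proof. by elim/quot_ind => x; rewrite quot_mulE mulr1. Qed.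
Fact quot_mulDl : left_distributive quot_mul +%R.
Proof.
elim/quot_ind => x; elim/quot_ind => y; elim/quot_ind => z.
by rewrite -quot_piD !quot_mulE mulrDl quot_piD.
Qed.
Fact quot_mulDr : right_distributive quot_mul +%R.
Proof.
elim/quot_ind => x; elim/quot_ind => y; elim/quot_ind => z.
by rewrite -quot_piD !quot_mulE mulrDr quot_piD.
Qed.
HB.instance Definition _ := GRing.Zmodule_isPzRing.Build Q
  quot_mulA quot_mul1q quot_mulq1 quot_mulDl quot_mulDr.

Fact quot_scaleA k l q : quot_scale k (quot_scale l q) = quot_scale (k * l) q.
Proof. by elim/quot_ind: q => x; rewrite !quot_scaleE uscaleA. Qed.
Fact quot_scale1 q : quot_scale 1 q = q.
Proof. by elim/quot_ind: q => x; rewrite quot_scaleE uscale1. Qed.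
Fact quot_scaleDr k p q :
  quot_scale k (p + q) = quot_scale k p + quot_scale k q.
Proof.
elim/quot_ind: p => x; elim/quot_ind: q => y.
by rewrite -quot_piD !quot_scaleE uscaleDr quot_piD.
Qed.
Fact quot_scaleDl k l q :
  quot_scale (k + l) q = quot_scale k q + quot_scale l q.
Proof. by elim/quot_ind: q => x; rewrite !quot_scaleE uscaleDl quot_piD. Qed.
Fact quot_scaleAl k (p q : Q) : quot_scale k (p * q) = quot_scale k p * q.
Proof.
rewrite /GRing.mul /=; elim/quot_ind: p => x; elim/quot_ind: q => y.
by rewrite !(quot_scaleE, quot_mulE) uscaleAl.
Qed.
Fact quot_scaleAr k (p q : Q) : quot_scale k (p * q) = p * quot_scale k q.
Proof.
rewrite /GRing.mul /=; elim/quot_ind: p => x; elim/quot_ind: q => y.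
by rewrite !(quot_scaleE, quot_mulE) uscaleAr.
Qed.
HB.instance Definition _ := PzRing_isUAlg.Build K Q
  quot_scaleA quot_scale1 quot_scaleDr quot_scaleDl quot_scaleAl quot_scaleAr.
End QuotAlg.

(* The free algebra on I is the monoid algebra of the free monoid {fmonom I}. *)
Definition freeAlg (K : fieldType) (I : choiceType) := {malg K[{fmonom I}]}.

Section FreeAlg.
Context (K : fieldType) (I : choiceType).
Local Notation F := (freeAlg K I).
HB.instance Definition _ := GRing.Lalgebra.on F.

Fact freeAlg_scaleAr (k : K) (x y : F) : k *: (x * y) = x * (k *: y).
Proof.
have cC (z : {malg K[{fmonom I}]}) : z * k%:MP = k%:MP * z.
  rewrite [z]monalgE mulr_suml mulr_sumr; apply: eq_bigr => m _.
  by rewrite !malgM_def !fgmulUU mulrC mul1m mulm1.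
by rewrite -[LHS]mul_malgC mulrA -cC -mulrA -[k *: y]mul_malgC.
Qed.
HB.instance Definition _ := PzRing_isUAlg.Build K F
  (@scalerA K F) (@scale1r K F) (@scalerDr K F)
  (fun k l x => @scalerDl K F x k l) (@scalerAl K F) freeAlg_scaleAr.

Definition fgen (i : I) : F := << fmu i >>.

(* E u v stands for the relation u = v.                                       *)
Inductive rel_ideal (E : F -> F -> Prop) : F -> Prop :=
| RelIdeal_rel u v : E u v -> rel_ideal E (u - v)
| RelIdeal_0 : rel_ideal E 0
| RelIdeal_sub x y : rel_ideal E x -> rel_ideal E y -> rel_ideal E (x - y)
| RelIdeal_mull a x : rel_ideal E x -> rel_ideal E (a * x)
| RelIdeal_mulr a x : rel_ideal E x -> rel_ideal E (x * a).

Context (E : F -> F -> Prop).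

Definition rel_idealb : F -> bool := fun x => `[< rel_ideal E x >].

Fact rel_ideal_zmod_closed : zmod_closed rel_idealb.
Proof.
split=> [|x y]; first by apply/asboolP; exact: RelIdeal_0.
by move=> /asboolP xJ /asboolP yJ; apply/asboolP; exact: RelIdeal_sub.
Qed.
HB.instance Definition _ :=
  GRing.isZmodClosed.Build F rel_idealb rel_ideal_zmod_closed.

Fact rel_idealMl (a x : F) : x \in rel_idealb -> a * x \in rel_idealb.
Proof. by move=> /asboolP xJ; apply/asboolP; exact: RelIdeal_mull. Qed.
Fact rel_idealMr (a x : F) : x \in rel_idealb -> x * a \in rel_idealb.
Proof. by move=> /asboolP xJ; apply/asboolP; exact: RelIdeal_mulr. Qed.
HB.instance Definition _ := isTwoSided.Build F rel_idealb
  rel_idealMl rel_idealMr.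

Definition presAlg := quotAlg rel_idealb.
HB.instance Definition _ := UAlg.on presAlg.
End FreeAlg.
Arguments fgen {K I} i.

Section Tensor.
Context (K : fieldType) (A B : uAlgType K).

(* The vector space with basis A * B, multiplied through the basis.           *)
Definition pretensor := {malg K[(A * B)%type]}.
Local Notation P := pretensor.
Implicit Types (x y z : P) (s t : A * B).

HB.instance Definition _ := GRing.Lmodule.on P.

Definition ptmul s t : A * B := (s.1 * t.1, s.2 * t.2).

Definition pretensor_one : P := << (1, 1) >>.
Definition pretensor_mul x y : P :=
  \sum_(s <- msupp x) \sum_(t <- msupp y) << x@_s * y@_t *g ptmul s t >>.

Lemma mkmalgUZ (c d : K) s : << c * d *g s >> = c *: << d *g s >> :> P.
Proof. by apply/malgP => t; rewrite mcoeffZ !mcoeffU mulrnAr. Qed.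

Lemma pretensor_mulEw (d1 d2 : {fset (A * B)%type}) x y :
  (msupp x `<=` d1)%fset -> (msupp y `<=` d2)%fset ->
  pretensor_mul x y =
    \sum_(s <- d1) \sum_(t <- d2) << x@_s * y@_t *g ptmul s t >>.
Proof.
move=> le1 le2; rewrite /pretensor_mul (big_fset_incl _ le1) /=.
  apply/eq_bigr=> s _; apply/big_fset_incl => // t _ /mcoeff_outdom ->.
  by rewrite mulr0 monalgU0.
move=> s _ /mcoeff_outdom xs.
by rewrite big1 => // t _; rewrite xs mul0r monalgU0.
Qed.

Fact pretensor_mulDl : left_distributive pretensor_mul +%R.
Proof.
move=> x y z; pose d := (msupp x `|` msupp y `|` msupp (x + y))%fset.
have sx : (msupp x `<=` d)%fset by rewrite /d -fsetUA fsubsetUl.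
have sy : (msupp y `<=` d)%fset by rewrite /d fsetUAC fsubsetUr.
have sxy : (msupp (x + y) `<=` d)%fset by rewrite fsubsetUr.
rewrite !(@pretensor_mulEw d (msupp z)) // -big_split /=.
apply: eq_bigr => s _; rewrite -big_split /=; apply: eq_bigr => t _.
by rewrite mcoeffD mulrDl monalgUD.
Qed.

Fact pretensor_mulDr : right_distributive pretensor_mul +%R.
Proof.
move=> z x y; pose d := (msupp x `|` msupp y `|` msupp (x + y))%fset.
have sx : (msupp x `<=` d)%fset by rewrite /d -fsetUA fsubsetUl.
have sy : (msupp y `<=` d)%fset by rewrite /d fsetUAC fsubsetUr.
have sxy : (msupp (x + y) `<=` d)%fset by rewrite fsubsetUr.
rewrite !(@pretensor_mulEw (msupp z) d) // -big_split /=.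
apply: eq_bigr => s _; rewrite -big_split /=; apply: eq_bigr => t _.
by rewrite mcoeffD mulrDr monalgUD.
Qed.

Lemma pretensor_mulU c d s t :
  pretensor_mul << c *g s >> << d *g t >> = << c * d *g ptmul s t >>.
Proof.
rewrite (pretensor_mulEw (msuppU_le (k := s)) (msuppU_le (k := t))).
by rewrite !big_seq_fset1 !mcoeffUU.
Qed.

Lemma pretensor_mul0l x : pretensor_mul 0 x = 0.
Proof. by apply: (addIr (pretensor_mul 0 x)); rewrite -pretensor_mulDl !add0r. Qed.
Lemma pretensor_mul0r x : pretensor_mul x 0 = 0.
Proof. by apply: (addIr (pretensor_mul x 0)); rewrite -pretensor_mulDr !add0r. Qed.

Lemma pretensor_ind (Q : P -> Prop) :
  Q 0 -> (forall x y, Q x -> Q y -> Q (x + y)) ->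
  (forall c s, Q << c *g s >>) -> forall x, Q x.
Proof. by move=> Q0 QD QU x; rewrite [x]monalgE; apply: big_ind. Qed.

Fact pretensor_mulA : associative pretensor_mul.
Proof.
elim/pretensor_ind => [y z|x x' IH IH' y z|c s].
- by rewrite !pretensor_mul0l.
- by rewrite !pretensor_mulDl IH IH'.
elim/pretensor_ind => [z|y y' IH IH' z|d t].
- by rewrite !(pretensor_mul0l, pretensor_mul0r).
- by rewrite !(pretensor_mulDl, pretensor_mulDr) IH IH'.
elim/pretensor_ind => [|z z' IH IH'|e u].
- by rewrite !pretensor_mul0r.
- by rewrite !pretensor_mulDr IH IH'.
by rewrite !pretensor_mulU /ptmul /= !mulrA.
Qed.

Fact pretensor_mul1l : left_id pretensor_one pretensor_mul.
Proof.
elim/pretensor_ind => [|x y IH IH'|c [a b]]; first exact: pretensor_mul0r.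
  by rewrite pretensor_mulDr IH IH'.
by rewrite pretensor_mulU /ptmul /= !mul1r.
Qed.

Fact pretensor_mul1r : right_id pretensor_one pretensor_mul.
Proof.
elim/pretensor_ind => [|x y IH IH'|c [a b]]; first exact: pretensor_mul0l.
  by rewrite pretensor_mulDl IH IH'.
by rewrite pretensor_mulU /ptmul /= !mulr1.
Qed.

HB.instance Definition _ := GRing.Zmodule_isPzRing.Build P
  pretensor_mulA pretensor_mul1l pretensor_mul1r
  pretensor_mulDl pretensor_mulDr.

Fact pretensor_scaleAl (k : K) x y : k *: (x * y) = k *: x * y.
Proof.
elim/pretensor_ind: x => [|x x' IH IH'|c s].
- by rewrite scaler0 !mul0r scaler0.
- by rewrite mulrDl !scalerDr IH IH' mulrDl.
elim/pretensor_ind: y => [|y y' IH IH'|d t].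
- by rewrite !mulr0 scaler0.
- by rewrite !mulrDr !scalerDr IH IH'.
by rewrite /GRing.mul /= -mkmalgUZ !pretensor_mulU -mkmalgUZ mulrA.
Qed.

Fact pretensor_scaleAr (k : K) x y : k *: (x * y) = x * (k *: y).
Proof.
elim/pretensor_ind: x => [|x x' IH IH'|c s].
- by rewrite !mul0r scaler0.
- by rewrite !mulrDl !scalerDr IH IH'.
elim/pretensor_ind: y => [|y y' IH IH'|d t].
- by rewrite scaler0 !mulr0 scaler0.
- by rewrite mulrDr !scalerDr IH IH' mulrDr.
by rewrite /GRing.mul /= -mkmalgUZ !pretensor_mulU -mkmalgUZ mulrCA.
Qed.

HB.instance Definition _ := PzRing_isUAlg.Build K P
  (@scalerA K P) (@scale1r K P) (@scalerDr K P)
  (fun k l x => @scalerDl K P x k l) pretensor_scaleAl pretensor_scaleAr.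

Inductive bilinear_span : P -> Prop :=
| BilinDl a a' b :
    bilinear_span (<< (a + a', b) >> - (<< (a, b) >> + << (a', b) >>))
| BilinDr a b b' :
    bilinear_span (<< (a, b + b') >> - (<< (a, b) >> + << (a, b') >>))
| BilinZl k a b : bilinear_span (<< (k • a, b) >> - k *: << (a, b) >>)
| BilinZr k a b : bilinear_span (<< (a, k • b) >> - k *: << (a, b) >>)
| Bilin0 : bilinear_span 0
| BilinP k x y :
    bilinear_span x -> bilinear_span y -> bilinear_span (k *: x + y).

Lemma bilinear_spanD x y :
  bilinear_span x -> bilinear_span y -> bilinear_span (x + y).
Proof. by move=> ? ?; rewrite -[x]scale1r; apply: BilinP. Qed.

Lemma bilinear_spanZ k x : bilinear_span x -> bilinear_span (k *: x).
Proof. by move=> ?; rewrite -[_ *: x]addr0; apply: BilinP => //; apply: Bilin0. Qed.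

Lemma bilinear_spanMl x y : bilinear_span y -> bilinear_span (x * y).
Proof.
elim/pretensor_ind: x => [|x x' IH IH' ys|c [a0 b0]].
- by rewrite mul0r => _; apply: Bilin0.
- by rewrite mulrDl; apply: bilinear_spanD; [apply: IH|apply: IH'].
rewrite -[c]mulr1 mkmalgUZ -pretensor_scaleAl => ys; apply: bilinear_spanZ.
elim: ys => [a a' b|a b b'|k a b|k a b||k u v _ IHu _ IHv].
- rewrite mulrBr mulrDr /GRing.mul /= !pretensor_mulU /ptmul /= mulr1 mulrDr.
  exact: BilinDl.
- rewrite mulrBr mulrDr /GRing.mul /= !pretensor_mulU /ptmul /= mulr1 mulrDr.
  exact: BilinDr.
- rewrite mulrBr -pretensor_scaleAr /GRing.mul /= !pretensor_mulU /ptmul /=.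
  rewrite mulr1 -uscaleAr; exact: BilinZl.
- rewrite mulrBr -pretensor_scaleAr /GRing.mul /= !pretensor_mulU /ptmul /=.
  rewrite mulr1 -uscaleAr; exact: BilinZr.
- by rewrite mulr0; exact: Bilin0.
- by rewrite mulrDr -pretensor_scaleAr; exact: BilinP.
Qed.

Lemma bilinear_spanMr x y : bilinear_span y -> bilinear_span (y * x).
Proof.
elim/pretensor_ind: x => [|x x' IH IH' ys|c [a0 b0]].
- by rewrite mulr0 => _; apply: Bilin0.
- by rewrite mulrDr; apply: bilinear_spanD; [apply: IH|apply: IH'].
rewrite -[c]mulr1 mkmalgUZ -pretensor_scaleAr => ys; apply: bilinear_spanZ.
elim: ys => [a a' b|a b b'|k a b|k a b||k u v _ IHu _ IHv].
- rewrite mulrBl mulrDl /GRing.mul /= !pretensor_mulU /ptmul /= mulr1 mulrDl.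
  exact: BilinDl.
- rewrite mulrBl mulrDl /GRing.mul /= !pretensor_mulU /ptmul /= mulr1 mulrDl.
  exact: BilinDr.
- rewrite mulrBl -pretensor_scaleAl /GRing.mul /= !pretensor_mulU /ptmul /=.
  rewrite mulr1 -uscaleAl; exact: BilinZl.
- rewrite mulrBl -pretensor_scaleAl /GRing.mul /= !pretensor_mulU /ptmul /=.
  rewrite mulr1 -uscaleAl; exact: BilinZr.
- by rewrite mul0r; exact: Bilin0.
- by rewrite mulrDl -pretensor_scaleAl; exact: BilinP.
Qed.

Definition bilinear_spanb : P -> bool := fun x => `[< bilinear_span x >].

Fact bilinear_span_zmod_closed : zmod_closed bilinear_spanb.
Proof.
split=> [|x y]; first by apply/asboolP; exact: Bilin0.
move=> /asboolP xJ /asboolP yJ; apply/asboolP.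
by rewrite addrC -scaleN1r; exact: BilinP.
Qed.
HB.instance Definition _ :=
  GRing.isZmodClosed.Build P bilinear_spanb bilinear_span_zmod_closed.

Fact bilinear_spanbMl x y : y \in bilinear_spanb -> x * y \in bilinear_spanb.
Proof. by move=> /asboolP yJ; apply/asboolP; exact: bilinear_spanMl. Qed.
Fact bilinear_spanbMr x y : y \in bilinear_spanb -> y * x \in bilinear_spanb.
Proof. by move=> /asboolP yJ; apply/asboolP; exact: bilinear_spanMr. Qed.
HB.instance Definition _ := isTwoSided.Build P bilinear_spanb
  bilinear_spanbMl bilinear_spanbMr.

(* As a vector space this is the usual tensor product (formal combinations of *)
(* pairs modulo bilinearity), and (a, b) * (a', b') = (a * a', b * b').       *)
Definition tensor := quotAlg bilinear_spanb.
HB.instance Definition _ := UAlg.on tensor.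
End Tensor.

Notation "A ⊗ B" := (tensor A B) : type_scope.

Section MatrixAlg.
Context (K : fieldType) (A : uAlgType K) (r : nat).
Implicit Types (M N : 'M[A]_r).

Definition mx_uscale (k : K) M : 'M[A]_r := map_mx (uscale k) M.

Fact mx_uscaleA k l M : mx_uscale k (mx_uscale l M) = mx_uscale (k * l) M.
Proof. by apply/matrixP => i j; rewrite !mxE uscaleA. Qed.
Fact mx_uscale1 M : mx_uscale 1 M = M.
Proof. by apply/matrixP => i j; rewrite !mxE uscale1. Qed.
Fact mx_uscaleDr k M N : mx_uscale k (M + N) = mx_uscale k M + mx_uscale k N.
Proof. by apply/matrixP => i j; rewrite !mxE uscaleDr. Qed.
Fact mx_uscaleDl k l M : mx_uscale (k + l) M = mx_uscale k M + mx_uscale l M.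
Proof. by apply/matrixP => i j; rewrite !mxE uscaleDl. Qed.

Lemma uscale0 k : k • (0 : A) = 0.
Proof. by rewrite -[0 in LHS](subrr 0) uscaleB subrr. Qed.
Lemma uscale_sum (I : Type) (s : seq I) k (f : I -> A) :
  k • (\sum_(i <- s) f i) = \sum_(i <- s) k • f i.
Proof. exact: (big_morph (uscale k) (uscaleDr k) (uscale0 k)). Qed.

Fact mx_uscaleAl k M N : mx_uscale k (M * N) = mx_uscale k M * N.
Proof.
apply/matrixP => i j; rewrite !mxE uscale_sum; apply: eq_bigr => l _.
by rewrite !mxE uscaleAl.
Qed.
Fact mx_uscaleAr k M N : mx_uscale k (M * N) = M * mx_uscale k N.
Proof.
apply/matrixP => i j; rewrite !mxE uscale_sum; apply: eq_bigr => l _.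
by rewrite !mxE uscaleAr.
Qed.
HB.instance Definition _ := PzRing_isUAlg.Build K 'M[A]_r
  mx_uscaleA mx_uscale1 mx_uscaleDr mx_uscaleDl mx_uscaleAl mx_uscaleAr.
End MatrixAlg.

Section Algebras.
Context (R : realType).
Local Notation C := R[i].

Inductive clifford_rel m : freeAlg C 'I_m -> freeAlg C 'I_m -> Prop :=
| CliffordRel j k :
    clifford_rel (fgen j * fgen k + fgen k * fgen j) ((j == k)%:R *+ 2).

Definition clifford m := presAlg (@clifford_rel m).
HB.instance Definition _ m := UAlg.on (clifford m).

(* Indices are shifted by one: w j is omega_(j+1), for 0 <= j <= 2n.          *)
Inductive A_rel n (F : uAlgType C) (w : 'I_n.*2.+1 -> F) (Ep Em l : F) :
    F -> F -> Prop :=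
| A_rel_EE : A_rel w Ep Em l (Ep * Em - Em * Ep)
    (- (4%:R^-1 • 1) + ('i%C ^+ n) • (l * \prod_(j < n.*2.+1) w j))
| A_rel_ww j k : A_rel w Ep Em l (w j * w k + w k * w j) ((j == k)%:R *+ 2)
| A_rel_Epw j : A_rel w Ep Em l (Ep * w j) (- (w j * Ep))
| A_rel_Emw j : A_rel w Ep Em l (Em * w j) (- (w j * Em)).

(* Generators: omega_j is inl j, E_+ is inr true, E_- is inr false; with       *)
(* Lambda, these are wrapped in Some, and Lambda is None.                     *)
Definition A_lambda_rel (lambda : C) n :
    freeAlg C ('I_n.*2.+1 + bool)%type -> freeAlg C ('I_n.*2.+1 + bool)%type -> Prop :=
  A_rel (fun j => fgen (inl j)) (fgen (inr true)) (fgen (inr false))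
        (lambda • 1).

Definition A_lambda (lambda : C) n := presAlg (@A_lambda_rel lambda n).
HB.instance Definition _ lambda n := UAlg.on (A_lambda lambda n).

Inductive A_Lambda_rel n :
    freeAlg C (option ('I_n.*2.+1 + bool))%type ->
    freeAlg C (option ('I_n.*2.+1 + bool))%type -> Prop :=
| A_Lambda_rel_A u v :
    A_rel (fun j => fgen (Some (inl j))) (fgen (Some (inr true)))
          (fgen (Some (inr false))) (fgen None) u v -> A_Lambda_rel u v
| A_Lambda_rel_central x : A_Lambda_rel (fgen None * x) (x * fgen None).

Definition A_Lambda n := presAlg (@A_Lambda_rel n).
HB.instance Definition _ n := UAlg.on (A_Lambda n).
End Algebras.

(* Main.v *)
Require Import Defs.
From HB Require Import structures.
From mathcomp Require Import all_boot all_order all_algebra finmap.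
From mathcomp Require Import boolp reals.
From mathcomp Require Import complex.
From mathcomp.multinomials Require Import monalg.

Set Implicit Arguments.
Unset Strict Implicit.
Unset Printing Implicit Defensive.

Import GRing.Theory Num.Theory.
Local Open Scope ring_scope.

(** For $v_1, \dots, v_{2n}$ anticommuting square roots of 1, put
    $G = i^n v_1 \cdots v_{2n}$.  Then $G^2 = 1$ and $G$ anticommutes with each
    $v_j$, so multiplication by $G$ turns an element anticommuting with all the
    $v_j$ into one commuting with them, and conversely.  Twisting
    $\omega_{2n+1}, E_+, E_-$ by $G$ therefore separates them from
    $\omega_1, \dots, \omega_{2n}$, and the commutator relation of level $n$
    becomes that of level $0$, since
    $i^n \omega_1 \cdots \omega_{2n+1} = G \omega_{2n+1}$.

    The Clifford algebra on $m + 2$ generators is the algebra of 2 x 2 matrices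
    over the one on $m$ generators: $\omega_{m+1}, \omega_{m+2}$ are the first
    two Pauli matrices, and the third one twists $\omega_1, \dots, \omega_m$.
    By induction $\mathcal C(2n)$ is a matrix algebra over $\mathbb C$. *)

(** * Homomorphisms of unital algebras, subalgebras and generating families *)

HB.mixin Record isUScalable (K : fieldType) (A B : uAlgType K) (f : A -> B) := {
  uhomZ : forall (k : K) (x : A), f (k • x) = k • f x
}.

HB.structure Definition UHom (K : fieldType) (A B : uAlgType K) :=
  {f of @GRing.RMorphism A B f & @isUScalable K A B f}.

Notation "{ 'uhom' A -> B }" := (UHom.type A B)
  (at level 0, A at level 98, B at level 99) : type_scope.

Section UAlgTheory.
Context (K : fieldType) (A : uAlgType K).
Implicit Types (k : K) (x y : A).

Lemma uscale0r x : 0 • x = 0.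
Proof. by apply: (addIr (0 • x)); rewrite -uscaleDl !add0r. Qed.

Lemma uscalerN k x : k • (- x) = - (k • x).
Proof. by apply: (addIr (k • x)); rewrite -uscaleDr !addNr uscale0. Qed.

Lemma uscaleNr k x : (- k) • x = - (k • x).
Proof. by apply: (addIr (k • x)); rewrite -uscaleDl !addNr uscale0r. Qed.

Lemma uscaleE k x : k • x = k • 1 * x.
Proof. by rewrite -uscaleAl mul1r. Qed.

Lemma uscale_comm k x : k • 1 * x = x * (k • 1).
Proof. by rewrite -uscaleAl -uscaleAr mul1r mulr1. Qed.

Lemma uscale_nat k n x : k • (x *+ n) = (k *+ n) • x.
Proof.
elim: n => [|n IH]; first by rewrite !mulr0n uscale0 uscale0r.
by rewrite !mulrS uscaleDr uscaleDl IH.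
Qed.

Lemma uscaleMM k l x y : (k • x) * (l • y) = (k * l) • (x * y).
Proof. by rewrite -uscaleAl -uscaleAr uscaleA. Qed.

(** Closure under zero and negation comes from scaling by 0 and by -1. *)
Definition subalg (P : A -> Prop) :=
  [/\ P 1, forall x y, P x -> P y -> P (x + y),
      forall x y, P x -> P y -> P (x * y) & forall k x, P x -> P (k • x)].

(** Stated as an induction principle, so that equality of homomorphisms and commutation can be
    checked on generators. *)
Definition generates (I : Type) (g : I -> A) :=
  forall P : A -> Prop, subalg P -> (forall i, P (g i)) -> forall x, P x.

Lemma generates_id : generates (@id A).
Proof. by move=> P _; exact. Qed.

Lemma subalg_comm y : subalg (fun x => x * y = y * x).
Proof.
split=> [|x z xy zy|x z xy zy|k x xy]; rewrite ?mul1r ?mulr1 //.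
- by rewrite mulrDl xy zy mulrDr.
- by rewrite -mulrA zy mulrA xy mulrA.
- by rewrite -uscaleAl xy uscaleAr.
Qed.
End UAlgTheory.

Lemma subalg_eq (K : fieldType) (A B : uAlgType K) (f g : {uhom A -> B}) :
  subalg (fun x => f x = g x).
Proof.
split=> [|x y fx fy|x y fx fy|k x fx]; rewrite ?rmorph1 //.
- by rewrite !rmorphD /= fx fy.
- by rewrite !rmorphM /= fx fy.
- by rewrite !uhomZ fx.
Qed.

Lemma uhom_ext (K : fieldType) (A B : uAlgType K) (I : Type) (s : I -> A)
    (f g : {uhom A -> B}) :
  generates s -> (forall i, f (s i) = g (s i)) -> f =1 g.
Proof. by move=> gs fg; apply: gs => //; apply: subalg_eq. Qed.

Lemma subalg_preim (K : fieldType) (A B : uAlgType K) (f : {uhom A -> B})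
    (P : B -> Prop) : subalg P -> subalg (P \o f).
Proof.
move=> [P1 PD PM PZ]; split=> [|u v|u v|k u] /=.
- by rewrite rmorph1.
- by rewrite rmorphD; exact: PD.
- by rewrite rmorphM; exact: PM.
- by rewrite uhomZ; exact: PZ.
Qed.

(** Centralizers are subalgebras, so commutation spreads from generators to all elements, one of the
    two factors at a time. *)
Lemma uhom_comm (K : fieldType) (A A' B : uAlgType K) (I I' : Type)
    (s : I -> A) (s' : I' -> A') (f : {uhom A -> B}) (f' : {uhom A' -> B}) :
  generates s -> generates s' ->
  (forall i i', f (s i) * f' (s' i') = f' (s' i') * f (s i)) ->
  forall x x', f x * f' x' = f' x' * f x.
Proof.
move=> gs gs' cs.
move=> x x'; apply: (gs (fun x => f x * f' x' = f' x' * f x)) => [|i].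
  exact: (subalg_preim f (subalg_comm (f' x'))).
apply/esym/(gs' (fun x' => f' x' * f (s i) = f (s i) * f' x')) => [|i'].
  exact: (subalg_preim f' (subalg_comm (f (s i)))).
exact/esym/cs.
Qed.

Lemma alg_isoP (K : fieldType) (A B : uAlgType K)
    (f : {uhom A -> B}) (g : {uhom B -> A}) :
  cancel f g -> cancel g f -> A ≃ B.
Proof. by move=> fK gK; exists f; split; [exact: uhomZ | exists g]. Qed.

Lemma uhom_exists (K : fieldType) (A B : uAlgType K) (h : A -> B) :
  h 1 = 1 -> {morph h : x y / x + y} -> {morph h : x y / x * y} ->
  (forall k x, h (k • x) = k • h x) -> exists f : {uhom A -> B}, f =1 h.
Proof.
move=> h1 hD hM hZ.
have h0 : h 0 = 0 by apply: (addIr (h 0)); rewrite -hD !add0r.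
pose hA := GRing.isNmodMorphism.Build A B h (conj h0 hD).
pose hR := GRing.isMonoidMorphism.Build A B h (conj h1 hM).
pose hS := isUScalable.Build K A B h hZ.
pose f : {uhom A -> B} := HB.pack h hA hR hS.
by exists f.
Qed.

(** The identity in bundled form, for showing with [uhom_ext] that a composite is the identity. *)
Lemma uhom_id (K : fieldType) (A : uAlgType K) :
  exists f : {uhom A -> A}, f =1 id.
Proof. exact: uhom_exists. Qed.

(** * Linear extension of a map given on a basis *)

Section MalgLift.
Context (K : fieldType) (T : choiceType) (V : uAlgType K) (h : T -> V).
Implicit Types (x y : {malg K[T]}).

Definition malg_lift x : V := \sum_(t <- msupp x) x@_t • h t.

Lemma malg_liftEw (d : {fset T}) x : (msupp x `<=` d)%fset ->
  malg_lift x = \sum_(t <- d) x@_t • h t.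
Proof.
move=> le; rewrite /malg_lift (big_fset_incl _ le) //= => t _ /mcoeff_outdom ->.
exact: uscale0r.
Qed.

Lemma malg_liftU c t : malg_lift << c *g t >> = c • h t.
Proof. by rewrite (malg_liftEw (msuppU_le (k := t))) big_seq_fset1 mcoeffUU. Qed.

Lemma malg_liftD : {morph malg_lift : x y / x + y}.
Proof.
move=> x y; pose d := (msupp x `|` msupp y `|` msupp (x + y))%fset.
rewrite !(@malg_liftEw d) ?fsubsetUr //; last 2 first.
- by rewrite /d fsetUAC fsubsetUr.
- by rewrite /d -fsetUA fsubsetUl.
by rewrite -big_split; apply: eq_bigr => t _; rewrite mcoeffD uscaleDl.
Qed.

Lemma malg_liftZ k x : malg_lift (k *: x) = k • malg_lift x.
Proof.
rewrite (malg_liftEw (msuppZ_le k x)) uscale_sum.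
by apply: eq_bigr => t _; rewrite mcoeffZ uscaleA.
Qed.

Lemma malg_lift0 : malg_lift 0 = 0.
Proof. by rewrite /malg_lift msupp0 big_seq_fset0. Qed.

Lemma malg_ind (Q : {malg K[T]} -> Prop) :
  Q 0 -> (forall x y, Q x -> Q y -> Q (x + y)) ->
  (forall c t, Q << c *g t >>) -> forall x, Q x.
Proof. by move=> Q0 QD QU x; rewrite [x]monalgE; apply: big_ind. Qed.
Lemma malg_scaleU (c : K) (t : T) : << c *g t >> = c *: << t >> :> {malg K[T]}.
Proof. by apply/malgP => u; rewrite mcoeffZ !mcoeffU mulrnAr mulr1. Qed.
End MalgLift.

(** * Universal property of the quotient by a two-sided ideal *)

Section QuotLift.
Context (K : fieldType) (A : uAlgType K) (J : twoSidedIdeal A).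

Lemma quot_piM : {morph @quot_pi K A J : x y / x * y}.
Proof. by move=> x y; rewrite /GRing.mul /= quot_mulE. Qed.

Lemma quot_piZ k x : quot_pi J (k • x) = k • quot_pi J x.
Proof. by rewrite -quot_scaleE. Qed.

Fact quot_pi_nmod_morphism : nmod_morphism (quot_pi J).
Proof.
split=> [|x y]; last exact: quot_piD.
by apply: (addIr (quot_pi J 0)); rewrite -quot_piD !add0r.
Qed.

Fact quot_pi_monoid_morphism : monoid_morphism (quot_pi J).
Proof. by split; [|exact: quot_piM]. Qed.

HB.instance Definition _ :=
  GRing.isNmodMorphism.Build A (quotAlg J) (quot_pi J) quot_pi_nmod_morphism.
HB.instance Definition _ :=
  GRing.isMonoidMorphism.Build A (quotAlg J) (quot_pi J) quot_pi_monoid_morphism.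
HB.instance Definition _ :=
  isUScalable.Build K A (quotAlg J) (quot_pi J) quot_piZ.

Lemma quot_lift (B : uAlgType K) (h : {uhom A -> B}) :
  (forall x, x \in J -> h x = 0) ->
  exists f : {uhom quotAlg J -> B}, forall x, f (quot_pi J x) = h x.
Proof.
(* Any choice of representatives works: two of them differ by an element of [J], which [h] kills. *)
move=> hJ; pose f0 (q : quotAlg J) := h (quot_repr q).
have f0E x : f0 (quot_pi J x) = h x.
  by apply/eqP; rewrite -subr_eq0 -rmorphB /= hJ // quot_repr_pi.
have [|||k x|f fE] := @uhom_exists K (quotAlg J) B f0.
- by rewrite -(rmorph1 (quot_pi J)) f0E rmorph1.
- elim/quot_ind=> x; elim/quot_ind=> y.
  by rewrite -quot_piD !f0E rmorphD.
- elim/quot_ind=> x; elim/quot_ind=> y.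
  by rewrite -quot_piM !f0E rmorphM.
- by elim/quot_ind: x => x; rewrite -quot_piZ !f0E uhomZ.
by exists f => x; rewrite fE f0E.
Qed.
End QuotLift.

(** * Universal properties of free and presented algebras *)

Section FreeLift.
Context (K : fieldType) (I : choiceType).
Local Notation F := (freeAlg K I).

Lemma freeAlg_mulU (c d : K) (m p : {fmonom I}) :
  (<< c *g m >> : F) * << d *g p >> = << c * d *g (mmul m p) >>.
Proof. by rewrite [LHS]malgM_def fgmulUU. Qed.

Lemma freeAlg_scaleU (c : K) (m : {fmonom I}) :
  << c *g m >> = c • (<< m >> : F).
Proof. exact: malg_scaleU. Qed.

Lemma freeAlg_ind (Q : F -> Prop) :
  Q 0 -> (forall x y : F, Q x -> Q y -> Q (x + y)) ->
  (forall c m, Q << c *g m >>) -> forall x, Q x.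
Proof. exact: malg_ind. Qed.

Lemma fmonom_ind (Q : {fmonom I} -> Prop) :
  Q mone -> (forall i m, Q m -> Q (mmul (fmu i) m)) -> forall m, Q m.
Proof.
move=> Q1 QM [s]; elim: s => [|i s IH].
  by rewrite (_ : FMonom _ = mone) //; apply: val_inj; rewrite /= fm1.
rewrite (_ : FMonom _ = mmul (fmu i) (FMonom s)); first exact: QM.
by apply: val_inj; rewrite /= fmM fmU.
Qed.

Lemma fgen_generates : generates (fgen : I -> F).
Proof.
move=> P [P1 PD PM PZ] Pg; elim/freeAlg_ind => [|x y|c m].
- by rewrite -(uscale0r (1 : F)); exact: PZ.
- exact: PD.
rewrite freeAlg_scaleU; apply: PZ; elim/fmonom_ind: m => [|i m IH]; first exact: P1.
by have := PM _ _ (Pg i) IH; rewrite /fgen freeAlg_mulU mulr1.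
Qed.

Lemma freeAlg_lift (B : uAlgType K) (v : I -> B) :
  exists f : {uhom F -> B}, forall i, f (fgen i) = v i.
Proof.
pose vm (m : {fmonom I}) := \prod_(i <- (m : seq I)) v i.
have vmM m p : vm (mmul m p) = vm m * vm p by rewrite /vm fmM big_cat.
(* From here on [malg_lift vm] is known only through these four properties. *)
have [L [LD LU LZ L0]] : exists L : F -> B,
    [/\ {morph L : x y / x + y}, forall c m, L << c *g m >> = c • vm m,
        forall k x, L (k • x) = k • L x & L 0 = 0].
  exists (malg_lift vm); split.
  - exact: malg_liftD.
  - exact: malg_liftU.
  - exact: malg_liftZ.
  - exact: malg_lift0.
have [|x y|f fE] := uhom_exists _ LD _ LZ.
- by rewrite [1]/(<< 1 *g mone >>) LU uscale1 /vm fm1 big_nil.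
- elim/freeAlg_ind: x => [|x x' IH IH'|c m].
  + by rewrite mul0r L0 mul0r.
  + by rewrite mulrDl !LD mulrDl; congr (_ + _); [exact: IH | exact: IH'].
  elim/freeAlg_ind: y => [|y y' IH IH'|d p].
  + by rewrite mulr0 L0 mulr0.
  + by rewrite mulrDr !LD mulrDr; congr (_ + _); [exact: IH | exact: IH'].
  by rewrite freeAlg_mulU !LU vmM uscaleMM.
by exists f => i; rewrite fE LU uscale1 /vm fmU big_seq1.
Qed.

Context (E : F -> F -> Prop).

Definition pgen (i : I) : presAlg E := quot_pi _ (fgen i).

Lemma pgen_generates : generates pgen.
Proof.
move=> P PS Pg; elim/quot_ind=> x.
apply: (@fgen_generates (P \o quot_pi (rel_idealb E))) => //.
exact: subalg_preim.
Qed.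

Lemma presAlg_hom : exists h : {uhom F -> presAlg E},
  (forall i, h (fgen i) = pgen i) /\ (forall u v, E u v -> h u = h v).
Proof.
exists (quot_pi (rel_idealb E)); split=> // u v Euv.
by apply/quot_pi_eq/asboolP; exact: RelIdeal_rel.
Qed.

(** The hypothesis quantifies over all [f] with the prescribed values because [freeAlg_lift] gives
    one only by existence. Its kernel is a two-sided ideal containing the relations, hence the ideal
    they generate. *)
Lemma presAlg_lift (B : uAlgType K) (v : I -> B) :
  (forall f : {uhom F -> B}, (forall i, f (fgen i) = v i) ->
    forall x y, E x y -> f x = f y) ->
  exists f : {uhom presAlg E -> B}, forall i, f (pgen i) = v i.
Proof.
move=> vE; have [h hv] := freeAlg_lift v.
have hJ x : x \in rel_idealb E -> h x = 0.
  move=> /asboolP; elim=> [x1 y1 /(vE h hv)|| | |].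
  - by rewrite rmorphB /= => ->; rewrite subrr.
  - exact: rmorph0.
  - by move=> x1 y1 _ hx _ hy; rewrite rmorphB /= hx hy subrr.
  - by move=> a x1 _ hx; rewrite rmorphM /= hx mulr0.
  - by move=> a x1 _ hx; rewrite rmorphM /= hx mul0r.
have [f fE] := quot_lift hJ.
by exists f => i; rewrite fE hv.
Qed.
End FreeLift.

(** * Tensor products: pure tensors, generators and universal property *)

Section TensorTheory.
Context (K : fieldType) (A B : uAlgType K).
Local Notation P := (pretensor A B).

Definition pure (a : A) (b : B) : A ⊗ B :=
  quot_pi (bilinear_spanb (A := A) (B := B)) << (a, b) >>.

Lemma pretensor_eq (x y : P) : bilinear_span (x - y) ->
  quot_pi (bilinear_spanb (A := A) (B := B)) x = quot_pi _ y.
Proof. by move=> xy; apply/quot_pi_eq/asboolP. Qed.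

Lemma pureDl a a' b : pure (a + a') b = pure a b + pure a' b.
Proof. by rewrite /pure -quot_piD; apply: pretensor_eq; exact: BilinDl. Qed.

Lemma pureDr a b b' : pure a (b + b') = pure a b + pure a b'.
Proof. by rewrite /pure -quot_piD; apply: pretensor_eq; exact: BilinDr. Qed.

Lemma pureZl k a b : pure (k • a) b = k • pure a b.
Proof. by rewrite /pure -quot_piZ; apply: pretensor_eq; exact: BilinZl. Qed.

Lemma pureZr k a b : pure a (k • b) = k • pure a b.
Proof. by rewrite /pure -quot_piZ; apply: pretensor_eq; exact: BilinZr. Qed.

Lemma pureM a a' b b' : pure a b * pure a' b' = pure (a * a') (b * b').
Proof. by rewrite /pure -quot_piM [_ * _]pretensor_mulU mulr1. Qed.

Definition tinl a := pure a 1.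
Definition tinr b := pure 1 b.

Fact tinl_nmod_morphism : nmod_morphism tinl.
Proof.
split=> [|x y]; last exact: pureDl.
by rewrite /tinl -(uscale0r (0 : A)) pureZl uscale0r.
Qed.

Fact tinr_nmod_morphism : nmod_morphism tinr.
Proof.
split=> [|x y]; last exact: pureDr.
by rewrite /tinr -(uscale0r (0 : B)) pureZr uscale0r.
Qed.

Fact tinl_monoid_morphism : monoid_morphism tinl.
Proof. by split=> [|x y]; rewrite /tinl ?pureM ?mulr1. Qed.

Fact tinr_monoid_morphism : monoid_morphism tinr.
Proof. by split=> [|x y]; rewrite /tinr ?pureM ?mulr1. Qed.

HB.instance Definition _ :=
  GRing.isNmodMorphism.Build A (A ⊗ B) tinl tinl_nmod_morphism.
HB.instance Definition _ :=
  GRing.isMonoidMorphism.Build A (A ⊗ B) tinl tinl_monoid_morphism.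
HB.instance Definition _ :=
  isUScalable.Build K A (A ⊗ B) tinl (fun k x => pureZl k x 1).
HB.instance Definition _ :=
  GRing.isNmodMorphism.Build B (A ⊗ B) tinr tinr_nmod_morphism.
HB.instance Definition _ :=
  GRing.isMonoidMorphism.Build B (A ⊗ B) tinr tinr_monoid_morphism.
HB.instance Definition _ :=
  isUScalable.Build K B (A ⊗ B) tinr (fun k => pureZr k 1).

Lemma pureE a b : pure a b = tinl a * tinr b.
Proof. by rewrite pureM mulr1 mul1r. Qed.

Lemma tinC a b : tinl a * tinr b = tinr b * tinl a.
Proof. by rewrite !pureM !mulr1 !mul1r. Qed.

Lemma tensor_generates (I J : Type) (s : I -> A) (t : J -> B) :
  generates s -> generates t ->
  generates (fun x : I + J =>
    match x with inl i => tinl (s i) | inr j => tinr (t j) end).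
Proof.
move=> gs gt Q QS Qg; have [Q1 QD QM QZ] := QS.
have Ql a : Q (tinl a).
  apply: (gs (Q \o tinl)) => [|i]; first exact: subalg_preim.
  exact: (Qg (inl i)).
have Qr b : Q (tinr b).
  apply: (gt (Q \o tinr)) => [|j]; first exact: subalg_preim.
  exact: (Qg (inr j)).
elim/quot_ind; elim/malg_ind => [|x y Qx Qy|c [a b]].
- by rewrite rmorph0 -(uscale0r 1); exact: QZ.
- by rewrite rmorphD; exact: QD.
rewrite malg_scaleU -[c *: _]/(c • (_ : P)) uhomZ; apply: QZ.
by have := QM _ _ (Ql a) (Qr b); rewrite -pureE.
Qed.

(** Multiplicativity is where commutation enters: [q b] has to move past [p a']. Bilinearity of the
    product in [C] makes the map vanish on [bilinear_span]. *)
Lemma tensor_lift (C : uAlgType K) (p : {uhom A -> C}) (q : {uhom B -> C}) :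
  (forall a b, p a * q b = q b * p a) ->
  exists f : {uhom A ⊗ B -> C}, forall a b, f (pure a b) = p a * q b.
Proof.
move=> pq; pose h (s : A * B) := p s.1 * q s.2.
have [L [LD LU LZ L0]] : exists L : P -> C,
    [/\ {morph L : x y / x + y}, forall c m, L << c *g m >> = c • h m,
        forall k x, L (k • x) = k • L x & L 0 = 0].
  exists (malg_lift h); split.
  - exact: malg_liftD.
  - exact: malg_liftU.
  - exact: malg_liftZ.
  - exact: malg_lift0.
have hM s t : h (ptmul s t) = h s * h t.
  by rewrite /h !rmorphM /= -!mulrA; congr (_ * _); rewrite !mulrA pq.
have [|x y|l lE] := uhom_exists _ LD _ LZ.
- by rewrite [1]/(<< 1 *g (1, 1) >>) LU uscale1 /h !rmorph1 mulr1.
- elim/pretensor_ind: x => [|x x' IH IH'|c m].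
  + by rewrite mul0r L0 mul0r.
  + by rewrite mulrDl !LD mulrDl; congr (_ + _); [exact: IH | exact: IH'].
  elim/pretensor_ind: y => [|y y' IH IH'|d t].
  + by rewrite mulr0 L0 mulr0.
  + by rewrite mulrDr !LD mulrDr; congr (_ + _); [exact: IH | exact: IH'].
  by rewrite [_ * _ in LHS]pretensor_mulU !LU hM uscaleMM.
have LU1 a b : l << (a, b) >> = p a * q b by rewrite lE LU uscale1.
have lJ x : bilinear_span x -> l x = 0.
  elim=> [a a' b|a b b'|k a b|k a b||k y z _ ly _ lz].
  - by rewrite rmorphB rmorphD /= !LU1 rmorphD mulrDl subrr.
  - by rewrite rmorphB rmorphD /= !LU1 rmorphD mulrDr subrr.
  - by rewrite -[k *: _]/(k • (_ : P)) rmorphB /= uhomZ !LU1 uhomZ uscaleAl subrr.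
  - by rewrite -[k *: _]/(k • (_ : P)) rmorphB /= uhomZ !LU1 uhomZ uscaleAr subrr.
  - exact: rmorph0.
  - by rewrite -[k *: _]/(k • (_ : P)) rmorphD /= uhomZ ly lz uscale0 addr0.
have [x /asboolP /lJ //|f fE] :=
  quot_lift (J := bilinear_spanb (A := A) (B := B)) (h := l).
by exists f => a b; rewrite fE LU1.
Qed.
End TensorTheory.

HB.instance Definition _ (K : fieldType) (A B C : uAlgType K)
    (f : {uhom A -> B}) (g : {uhom B -> C}) :=
  isUScalable.Build K A C (g \o f)
    (fun k x => etrans (congr1 g (uhomZ k x)) (uhomZ k (f x))).

(** The base field as an algebra over itself, which makes ['M[K^o]_N] a [uAlgType]. *)
HB.instance Definition _ (K : fieldType) := PzRing_isUAlg.Build K K^o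
  (@scalerA K K^o) (@scale1r K K^o) (@scalerDr K K^o)
  (fun k l x => @scalerDl K K^o x k l) (@scalerAl K K^o) (@scalerAr K K^o).

Lemma uhom_inv (K : fieldType) (A B : uAlgType K) (f : {uhom A -> B}) :
  bijective f -> exists g : {uhom B -> A}, cancel f g /\ cancel g f.
Proof.
case=> g fK gK; have [|x y|x y|k x|h hE] := @uhom_exists K B A g.
- by rewrite -(rmorph1 f) fK.
- by apply: (can_inj fK); rewrite rmorphD /= !gK.
- by apply: (can_inj fK); rewrite rmorphM /= !gK.
- by apply: (can_inj fK); rewrite uhomZ !gK.
by exists h; split=> x; rewrite hE.
Qed.

(** * Tensoring with a matrix algebra over the base field *)

Section MatrixTensor.
Context (K : fieldType) (C A : uAlgType K) (N : nat).
Local Notation MK := 'M[K^o]_N.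

Lemma mx_alg_hom : exists f : {uhom MK -> 'M[A]_N},
  forall M, f M = \matrix_(i, j) ((M i j : K) • 1).
Proof.
have [|M M'|M M'|k M|f fE] :=
  @uhom_exists K MK 'M[A]_N (fun M => \matrix_(i, j) ((M i j : K) • 1)).
- apply/matrixP => i j; rewrite !mxE.
  by case: (i == j); rewrite ?uscale1 ?uscale0r.
- by apply/matrixP => i j; rewrite !mxE uscaleDl.
- apply/matrixP => i j; rewrite !mxE.
  rewrite (big_morph (fun k : K => k • (1 : A))
    (fun k l => uscaleDl k l 1) (uscale0r 1)).
  by apply: eq_bigr => l _; rewrite !mxE uscaleMM mulr1.
- by apply/matrixP => i j; rewrite !mxE uscaleA.
by exists f.
Qed.

Lemma mx_scalar_hom : exists f : {uhom A -> 'M[A]_N}, forall a, f a = a%:M.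
Proof.
have [|a b|a b|k a|f fE] := @uhom_exists K A 'M[A]_N (fun a => a%:M) => //.
- by apply/matrixP => i j; rewrite !mxE mulrnDl.
- by rewrite -[RHS]scalar_mxM.
- by apply/matrixP => i j; rewrite !mxE; case: (i == j); rewrite ?uscale0.
by exists f.
Qed.

Lemma mx_deltaM (i k l j : 'I_N) :
  (delta_mx i k : MK) * delta_mx l j = (k == l)%:R • delta_mx i j.
Proof.
rewrite [LHS]mul_delta_mx_cond; case: (k == l); first by rewrite uscale1.
by rewrite uscale0r.
Qed.

Lemma mx_sum_delta (M : MK) : M = \sum_i \sum_j (M i j : K) • delta_mx i j.
Proof.
rewrite {1}[M]matrix_sum_delta; apply: eq_bigr => i _; apply: eq_bigr => j _.
by apply/matrixP => x y; rewrite !mxE.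
Qed.

Lemma pure_sum (I : Type) (r : seq I) (c : C) (h : I -> A) :
  pure c (\sum_(i <- r) h i) = \sum_(i <- r) pure c (h i).
Proof.
apply: (big_morph (pure c) (pureDr c)).
by rewrite -(uscale0r 0) pureZr uscale0r.
Qed.

Lemma pure0l (a : A) : pure (0 : C) a = 0.
Proof. by rewrite -(uscale0r 0) pureZl uscale0r. Qed.

Lemma pure0r (c : C) : pure c (0 : A) = 0.
Proof. by rewrite -(uscale0r 0) pureZr uscale0r. Qed.

(** The elements [psi (delta_mx i j)] multiply like matrix units and the diagonal ones sum to 1;
    this makes the map multiplicative and unital. *)
Lemma mx_tensor_hom (psi : {uhom MK -> C}) :
  exists g : {uhom 'M[A]_N -> C ⊗ A}, forall M,
    g M = \sum_i \sum_j pure (psi (delta_mx i j)) (M i j).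
Proof.
pose g0 (M : 'M[A]_N) : C ⊗ A :=
  \sum_i \sum_j pure (psi (delta_mx i j)) (M i j).
have sum1 : \sum_i tinl A (psi (delta_mx i i)) = 1.
  rewrite -(rmorph1 (tinl A \o psi)) [1 in RHS]mx_sum_delta.
  rewrite rmorph_sum; apply: eq_bigr => i _.
  rewrite rmorph_sum (bigD1 i) //= mxE eqxx uscale1 big1 ?addr0 // => j ji.
  by rewrite mxE eq_sym (negPf ji) uscale0r !rmorph0.
have [|M M'|M M'|k M|g gE] := @uhom_exists K 'M[A]_N (C ⊗ A) g0.
- rewrite -sum1; apply: eq_bigr => i _.
  rewrite (bigD1 i) //= mxE eqxx big1 ?addr0 // => j ji.
  by rewrite mxE eq_sym (negPf ji) pure0r.
- rewrite -big_split; apply: eq_bigr => i _; rewrite -big_split.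
  by apply: eq_bigr => j _; rewrite mxE pureDr.
- rewrite mulr_suml; apply: eq_bigr => i _.
  rewrite mulr_suml.
  under eq_bigr => j _ do rewrite mxE pure_sum.
  rewrite exchange_big; apply: eq_bigr => l _.
  (* Only row [l] of the second factor contributes: the product of the units at [(i, l)] and
     [(l', j)] vanishes when [l'] differs from [l]. *)
  rewrite mulr_sumr [RHS](bigD1 l) //= [X in _ = _ + X]big1 ?addr0 => [|l' ll'].
    rewrite mulr_sumr; apply: eq_bigr => j _.
    by rewrite pureM -rmorphM /= mx_deltaM eqxx uscale1.
  rewrite mulr_sumr big1 // => j _.
  by rewrite pureM -rmorphM /= mx_deltaM eq_sym (negPf ll') uscale0r rmorph0 pure0l.
- rewrite uscale_sum; apply: eq_bigr => i _; rewrite uscale_sum.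
  by apply: eq_bigr => j _; rewrite mxE pureZr.
by exists g.
Qed.

(** The map sends [c ⊗ a] to [phi c] times the scalar matrix [a]; its inverse expands a matrix in
    matrix units and pulls these back to [C]. *)
Lemma tensor_mx_iso (phi : {uhom C -> MK}) :
  bijective phi -> (C ⊗ A) ≃ 'M[A]_N.
Proof.
move=> /uhom_inv[psi [phiK psiK]].
have [em emE] := mx_alg_hom; have [sc scE] := mx_scalar_hom.
(* The entries of [em (phi c)] are scalar multiples of 1, so they commute with [a] even when [A] is
   not commutative. *)
have comm c a : (em \o phi) c * sc a = sc a * (em \o phi) c.
  apply/matrixP => i j; rewrite /= scE emE.
  rewrite [LHS](_ : _ = \sum_k ((phi c i k : K) • 1) * (a *+ (k == j))); last first.
    by rewrite mxE; apply: eq_bigr => k _; rewrite !mxE.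
  rewrite [RHS](_ : _ = \sum_k (a *+ (i == k)) * ((phi c k j : K) • 1)); last first.
    by rewrite mxE; apply: eq_bigr => k _; rewrite !mxE.
  rewrite [LHS](bigD1 j) //= [RHS](bigD1 i) //= !eqxx !mulr1n uscale_comm.
  rewrite !big1 // => k /negPf; last by move=> ->; rewrite mulr0.
  by rewrite eq_sym => ->; rewrite mul0r.
have [f fE] := tensor_lift comm.
have [g gE] := mx_tensor_hom psi.
apply: (@alg_isoP _ _ _ f g) => [x|M].
  have [h hE] := uhom_id (C ⊗ A).
  rewrite -[RHS]hE -[LHS]/((g \o f) x); move: x.
  apply: (uhom_ext
    (tensor_generates (@generates_id _ C) (@generates_id _ A))) => -[c|a];
    rewrite hE /= fE gE.
    rewrite rmorph1 mulr1 /= emE -[in RHS](phiK c) [phi c in RHS]mx_sum_delta.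
    rewrite !rmorph_sum; apply: eq_bigr => i _; rewrite !rmorph_sum.
    by apply: eq_bigr => j _; rewrite mxE pureZr /= !uhomZ.
  (* On [1 ⊗ a] only the diagonal units survive, so the 1 of the left factor is expanded as the sum
     of their images under [psi]. *)
  rewrite rmorph1 mul1r scE -[RHS](mul1r (tinr _ _)).
  rewrite -(rmorph1 (tinl A \o psi)) [1 in RHS]mx_sum_delta.
  rewrite rmorph_sum mulr_suml; apply: eq_bigr => i _.
  rewrite rmorph_sum mulr_suml; apply: eq_bigr => j _.
  rewrite !mxE; case: (i == j); last first.
    by rewrite mulr0n uscale0r rmorph0 mul0r pure0r.
  by rewrite uscale1 /= -pureE.
rewrite gE rmorph_sum [RHS]matrix_sum_delta; apply: eq_bigr => i _.
rewrite rmorph_sum; apply: eq_bigr => j _.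
rewrite /= fE comm /= psiK scE emE [LHS]mul_scalar_mx; congr (_ *: _).
apply/matrixP => x y; rewrite !mxE.
by case: (_ && _); rewrite ?uscale1 ?uscale0r.
Qed.
End MatrixTensor.

(** * Two by two block matrices and their matrix units *)

Section Block.
Context (K : fieldType) (N : nat).
Local Notation MN := 'M[K^o]_N.
Local Notation MNN := 'M[K^o]_(N + N).
Implicit Types (a b c d : MN).

Lemma block_mxM a b c d a' b' c' d' :
  (block_mx a b c d : MNN) * block_mx a' b' c' d' =
  block_mx (a * a' + b * c') (a * b' + b * d')
           (c * a' + d * c') (c * b' + d * d').
Proof. exact: mulmx_block. Qed.

Lemma block_mxZ (k : K) a b c d :
  k • (block_mx a b c d : MNN) = block_mx (k • a) (k • b) (k • c) (k • d).
Proof. exact: map_block_mx. Qed.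

Lemma block_mx1 : block_mx 1 0 0 1 = 1 :> MNN.
Proof. exact/esym/scalar_mx_block. Qed.

Lemma mx_block_diag_hom : exists f : {uhom MN -> MNN},
  forall a, f a = block_mx a 0 0 a.
Proof.
have [|a b|a b|k a|f fE] := @uhom_exists K MN MNN (fun a => block_mx a 0 0 a).
- exact: block_mx1.
- by rewrite add_block_mx !addr0.
- by rewrite block_mxM !(mul0r, mulr0, addr0, add0r).
- by rewrite block_mxZ !uscale0.
by exists f.
Qed.

(* [p], [p * s], [q * s] and [q] are the four matrix units. *)
Lemma mx_block_hom (B : uAlgType K) (u : {uhom MN -> B}) (p q s : B) :
  p + q = 1 -> p * p = p -> s * s = 1 -> s * p = q * s ->
  (forall a, p * u a = u a * p) -> (forall a, s * u a = u a * s) ->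
  exists g : {uhom MNN -> B}, forall a b c d,
    g (block_mx a b c d) =
    u a * p + u b * (p * s) + (u c * (q * s) + u d * q).
Proof.
move=> pq pp ss sp pu su.
have q_def : q = 1 - p by rewrite -pq addrC addKr.
have qp : q * p = 0 by rewrite q_def mulrBl mul1r pp subrr.
have pq0 : p * q = 0 by rewrite q_def mulrBr mulr1 pp subrr.
have qq : q * q = q by rewrite {1}q_def mulrBl mul1r pq0 subr0.
have sq : s * q = p * s.
  by rewrite q_def mulrBr mulr1 sp q_def mulrBl mul1r opprB addrC subrK.
have qu a : q * u a = u a * q by rewrite q_def mulrBl mulrBr mul1r mulr1 pu.
have psu a : p * s * u a = u a * (p * s) by rewrite -mulrA su !mulrA pu.
have qsu a : q * s * u a = u a * (q * s) by rewrite -mulrA su !mulrA qu.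
have unitM x y e f : e * u y = u y * e -> u x * e * (u y * f) = u (x * y) * (e * f).
  by move=> ey; rewrite rmorphM mulrA -(mulrA (u x)) ey !mulrA.
pose g0 (M : MNN) := u (ulsubmx M) * p + u (ursubmx M) * (p * s) +
  (u (dlsubmx M) * (q * s) + u (drsubmx M) * q).
have g0E a b c d : g0 (block_mx a b c d) =
    u a * p + u b * (p * s) + (u c * (q * s) + u d * q).
  by rewrite /g0 block_mxKul block_mxKur block_mxKdl block_mxKdr.
have [|M M'|M M'|k M|g gE] := @uhom_exists K MNN B g0.
- by rewrite -block_mx1 g0E !rmorph1 !rmorph0 !mul0r !mul1r addr0 add0r.
- rewrite -[M]submxK -[M']submxK add_block_mx !g0E !rmorphD !mulrDl.
  by rewrite [RHS]addrACA; congr (_ + _); exact: addrACA.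
- rewrite -[M]submxK -[M']submxK block_mxM !g0E !rmorphD.
  rewrite !mulrDr !mulrDl !unitM //.
  (* Together with [pp], [pq0], [qp] and [qq], the full multiplication table of the four matrix
     units. *)
  have p_ps : p * (p * s) = p * s by rewrite mulrA pp.
  have p_qs : p * (q * s) = 0 by rewrite mulrA pq0 mul0r.
  have q_ps : q * (p * s) = 0 by rewrite mulrA qp mul0r.
  have q_qs : q * (q * s) = q * s by rewrite mulrA qq.
  have ps_p : p * s * p = 0 by rewrite -mulrA sp p_qs.
  have ps_ps : p * s * (p * s) = 0 by rewrite mulrA ps_p mul0r.
  have ps_q : p * s * q = p * s by rewrite -mulrA sq p_ps.
  have ps_qs : p * s * (q * s) = p by rewrite mulrA ps_q -mulrA ss mulr1.
  have qs_p : q * s * p = q * s by rewrite -mulrA sp q_qs.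
  have qs_q : q * s * q = 0 by rewrite -mulrA sq q_ps.
  have qs_ps : q * s * (p * s) = q by rewrite mulrA qs_p -mulrA ss mulr1.
  have qs_qs : q * s * (q * s) = 0 by rewrite mulrA qs_q mul0r.
  rewrite pp p_ps p_qs pq0 ps_p ps_ps ps_qs ps_q.
  rewrite qs_p qs_ps qs_qs qs_q qp q_ps q_qs qq.
  rewrite !mulr0 !(addr0, add0r).
  by rewrite [RHS]addrACA [LHS]addrACA; congr (_ + _); exact: addrACA.
- rewrite -[M]submxK block_mxZ !g0E !uhomZ /=.
  by rewrite -!uscaleAl -!uscaleDr.
by exists g => a b c d; rewrite gE g0E.
Qed.
End Block.

(** * Families extended by a last entry *)

Section Snoc.
Context (m : nat) (T : Type).

(** The new entry sits at [ord_max], the place of $\omega_{2n+1}$ and the factor that [big_ord_recr]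
    splits off a product. *)
Definition snoc (v : 'I_m -> T) (a : T) (j : 'I_m.+1) : T :=
  if unlift ord_max j is Some i then v i else a.

Lemma snoc_lift v a i : snoc v a (lift ord_max i) = v i.
Proof. by rewrite /snoc liftK. Qed.

Lemma snoc_widen v a i : snoc v a (widen_ord (leqnSn m) i) = v i.
Proof.
rewrite -[RHS](snoc_lift v a); congr snoc.
exact/val_inj/esym/lift_max.
Qed.

Lemma snoc_max v a : snoc v a ord_max = a.
Proof. by rewrite /snoc unlift_none. Qed.
End Snoc.

Lemma prod_snoc (A : pzRingType) m (v : 'I_m -> A) (a : A) :
  \prod_j snoc v a j = (\prod_j v j) * a.
Proof.
rewrite big_ord_recr /= snoc_max; congr (_ * _).
by apply: eq_bigr => i _; rewrite snoc_widen.
Qed.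

(** * Signs in products of anticommuting square roots of 1 *)

Section Anticommuting.
Context (A : pzRingType).
Implicit Types (a b x : A).

Definition anti a b := a * b = - (b * a).

Lemma antiC a b : anti a b -> anti b a.
Proof. by rewrite /anti => ->; rewrite opprK. Qed.

Lemma anti_mul_comm a b x : anti x a -> anti x b -> x * (a * b) = a * b * x.
Proof. by move=> xa xb; rewrite mulrA xa mulNr -mulrA xb mulrN opprK mulrA. Qed.

(** Splits off two entries at once, for inductions on [n] over families of even length [n.*2]. *)
Lemma prod_double m (v : 'I_m.+1.*2 -> A) :
  exists w a b, v = snoc (snoc w a) b.
Proof.
exists (fun i => v (lift ord_max (lift ord_max i))), (v (lift ord_max ord_max)).
exists (v ord_max); apply/funext => j; rewrite /snoc.
by case: unliftP => [i ->|-> //]; case: unliftP => [k ->|->].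
Qed.

(** The number of factors is even, so the signs cancel in pairs. *)
Lemma anti_prod_comm n (v : 'I_n.*2 -> A) x :
  (forall j, anti x (v j)) -> x * \prod_j v j = (\prod_j v j) * x.
Proof.
elim: n v => [|n IH] v; first by rewrite !big_ord0 mulr1 mul1r.
have [w [a [b ->]]] := prod_double v; move=> xv.
have xb := xv ord_max; rewrite snoc_max in xb.
have xa := xv (lift ord_max ord_max); rewrite snoc_lift snoc_max in xa.
have xw j : anti x (w j).
  by have := xv (lift ord_max (lift ord_max j)); rewrite !snoc_lift.
rewrite !prod_snoc -mulrA mulrA (IH _ xw) -!mulrA; congr (_ * _).
by rewrite [RHS]mulrA; exact: anti_mul_comm.
Qed.

Definition cliff m (v : 'I_m -> A) :=
  (forall j, v j * v j = 1) /\ (forall j k, j != k -> anti (v j) (v k)).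

Lemma cliff_snoc m (v : 'I_m -> A) a :
  cliff v -> a * a = 1 -> (forall j, anti a (v j)) -> cliff (snoc v a).
Proof.
move=> [vv vk] aa av; split=> [j|j k]; rewrite /snoc.
  by case: unliftP => [i _|_].
case: unliftP => [i ->|->]; case: unliftP => [l ->|->] //; last by rewrite eqxx.
  by rewrite (inj_eq (lift_inj (h := _))); exact: vk.
by move=> _; exact: antiC.
Qed.

Lemma snoc_cliff m (v : 'I_m -> A) a :
  cliff (snoc v a) -> [/\ cliff v, a * a = 1 & forall j, anti a (v j)].
Proof.
move=> [vv vk]; split.
- split=> [j|j k jk]; first by have := vv (lift ord_max j); rewrite snoc_lift.
  have := vk (lift ord_max j) (lift ord_max k).
  by rewrite (inj_eq (lift_inj (h := _))) !snoc_lift; exact.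
- by have := vv ord_max; rewrite snoc_max.
by move=> j; have := vk ord_max (lift ord_max j) (neq_lift _ _);
  rewrite snoc_max snoc_lift.
Qed.

(** [v k] commutes with itself and anticommutes with the other $2n-1$ factors: an odd number of
    signs remains. *)
Lemma cliff_prod_anti n (v : 'I_n.*2 -> A) k :
  cliff v -> anti (\prod_j v j) (v k).
Proof.
elim: n v k => [|n IH] v; first by case.
have [w [a [b ->]]] := prod_double v; rewrite prod_snoc prod_snoc => k.
move=> /snoc_cliff[/snoc_cliff[cw aa aw] bb bv].
have ba : anti b a by have := bv ord_max; rewrite snoc_max.
have bw j : anti b (w j) by have := bv (lift ord_max j); rewrite snoc_lift.
have Pa := anti_prod_comm aw; have Pb := anti_prod_comm bw.
rewrite /snoc -mulrA; case: unliftP => [{k}k _|_].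
  case: unliftP => [{k}k _|_]; rewrite /anti.
    rewrite -mulrA -(anti_mul_comm (antiC (aw k)) (antiC (bw k))).
    by rewrite !mulrA (IH w k cw) !mulNr.
  rewrite (mulrA a _ (a * b)) Pa -!mulrA ba.
  by rewrite !mulrN.
by rewrite /anti (mulrA b) Pb -!mulrA (mulrA b) ba mulNr -!mulrA bb !mulrN opprK.
Qed.

(** Each pair contributes $(ab)^2=-1$, once [a] and [b] have moved past the even product of the
    preceding factors. *)
Lemma cliff_prod_sq n (v : 'I_n.*2 -> A) :
  cliff v -> (\prod_j v j) * (\prod_j v j) = (-1) ^+ n.
Proof.
elim: n v => [|n IH] v; first by rewrite !big_ord0 mulr1.
have [w [a [b ->]]] := prod_double v; rewrite prod_snoc prod_snoc.
move=> /snoc_cliff[/snoc_cliff[cw aa aw] bb bv].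
have ba : anti b a by have := bv ord_max; rewrite snoc_max.
have bw j : anti b (w j) by have := bv (lift ord_max j); rewrite snoc_lift.
have Pa := anti_prod_comm aw; have Pb := anti_prod_comm bw.
rewrite exprSr -(IH w cw) -!mulrA; congr (_ * _).
rewrite (mulrA b) Pb -(mulrA _ b) (mulrA a) Pa -!mulrA; congr (_ * _).
by rewrite (mulrA b) ba mulNr -mulrA bb mulr1 mulrN aa.
Qed.
End Anticommuting.

(** * Clifford algebras as complex matrix algebras *)

Section Clifford.
Local Notation simp := (mul0r, mulr0, mul1r, mulr1, addr0, add0r, mulrN, mulNr,
  opprK, oppr0).
Context (R : realType).
Local Notation C := R[i].

Lemma half_double (A : uAlgType C) (x : A) : 2^-1 • (x *+ 2) = x.
Proof.
by rewrite uscale_nat -[2^-1 *+ 2]mulr_natr mulVf ?uscale1 // pnatr_eq0.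
Qed.

(** The diagonal relations read $2v_j^2=2$, and 2 is invertible in the scalars. *)
Lemma cliffP (A : uAlgType C) m (v : 'I_m -> A) :
  (forall j k, v j * v k + v k * v j = (j == k)%:R *+ 2) <-> cliff v.
Proof.
split=> [vv|[vv va] j k]; last first.
  case: eqVneq => [->|jk]; first by rewrite vv mulr2n.
  by rewrite (va _ _ jk) addNr mul0rn.
split=> [j|j k jk].
  by rewrite -[LHS]half_double (mulr2n (_ * _)) vv eqxx half_double.
by apply/eqP; rewrite /anti -subr_eq0 opprK vv (negPf jk) mul0rn.
Qed.

Lemma uhom_anticomm (A B : uAlgType C) (f : {uhom A -> B}) x y :
  f (x * y + y * x) = f x * f y + f y * f x.
Proof. by rewrite rmorphD !rmorphM. Qed.

Lemma uhom_nat2 (A B : uAlgType C) (f : {uhom A -> B}) n :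
  f (n%:R *+ 2) = n%:R *+ 2.
Proof. by rewrite rmorphMn /= rmorph_nat. Qed.

Definition cgen m (j : 'I_m) : clifford R m := pgen _ j.

Lemma cgen_generates m : generates (@cgen m).
Proof. exact: pgen_generates. Qed.

Lemma cgen_cliff m : cliff (@cgen m).
Proof.
have [h [hg hr]] : exists h : {uhom freeAlg C 'I_m -> clifford R m},
    (forall i, h (fgen i) = cgen i) /\ (forall u v, clifford_rel u v -> h u = h v).
  exact: presAlg_hom.
apply/cliffP => j k; rewrite -!hg -uhom_anticomm (hr _ _ (CliffordRel R j k)).
exact: uhom_nat2.
Qed.

Lemma clifford_lift (B : uAlgType C) m (v : 'I_m -> B) : cliff v ->
  exists f : {uhom clifford R m -> B}, forall j, f (cgen j) = v j.
Proof.
move=> /cliffP vv; apply: presAlg_lift => f fv _ _ [j k].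
by rewrite uhom_anticomm uhom_nat2 !fv vv.
Qed.

(** The universal property, with [generates] in place of uniqueness of the lift, which follows from
    it by [uhom_ext]. The matrix isomorphisms below rest on this alone and never look inside the
    quotient defining [clifford]. *)
Definition is_clifford m (T : uAlgType C) (g : 'I_m -> T) :=
  [/\ cliff g, generates g &
      forall (B : uAlgType C) (v : 'I_m -> B), cliff v ->
        exists f : {uhom T -> B}, forall j, f (g j) = v j].

Lemma clifford_is_clifford m : is_clifford (@cgen m).
Proof.
split; [exact: cgen_cliff | exact: cgen_generates | move=> B v].
exact: clifford_lift.
Qed.

Lemma i_sq : 'i%C * 'i%C = -1 :> C.
Proof. by rewrite -expr2 sqr_i. Qed.

(** Without generators every element is a multiple of 1, so the single entry of its image recovers
    it. *)
Lemma clifford0_mx (T : uAlgType C) (g : 'I_0 -> T) :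
  is_clifford g -> exists f : {uhom T -> 'M[C^o]_1}, bijective f.
Proof.
case=> _ gen lift; have [|f _] := lift 'M[C^o]_1 (fun=> 1); first by split=> -[].
exists f; exists (fun M : 'M[C^o]_1 => (M 0 0 : C) • 1) => [x|M]; last first.
  rewrite uhomZ rmorph1; apply/matrixP => i j.
  rewrite !mxE !ord1 eqxx; exact: mulr1.
have [k ->] : exists k : C, x = k • 1.
  apply: (gen (fun x => exists k : C, x = k • 1)) => [|[]//].
  split=> [|_ _ [k ->] [l ->]|_ _ [k ->] [l ->]|l _ [k ->]].
  - by exists 1; rewrite uscale1.
  - by exists (k + l); rewrite uscaleDl.
  - by exists (k * l); rewrite uscaleMM mulr1.
  - by exists (l * k); rewrite uscaleA.
rewrite uhomZ rmorph1; congr (_ • _); rewrite !mxE eqxx; exact: mulr1.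
Qed.

(** [f] is given by Pauli matrices on generators. For its inverse, the elements [c * v j] yield an
    image of [T1] commuting with [a] and [c], and [a] and [c] supply 2 x 2 matrix units over it. *)
Lemma cliffordSS_mx m N (T1 T2 : uAlgType C) (g1 : 'I_m -> T1)
    (g2 : 'I_m.+2 -> T2) (phi : {uhom T1 -> 'M[C^o]_N}) :
  is_clifford g1 -> is_clifford g2 -> bijective phi ->
  exists f : {uhom T2 -> 'M[C^o]_(N + N)}, bijective f.
Proof.
move=> [[cc ca] gen1 lift1] [cg2 gen2 lift2] /uhom_inv[psi [phiK psiK]].
have [v [a [b gE]]] : exists v a b, g2 = snoc (snoc v a) b.
  exists (fun i => g2 (lift ord_max (lift ord_max i))), (g2 (lift ord_max ord_max)).
  exists (g2 ord_max); apply/funext => j; rewrite /snoc.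
  by case: unliftP => [i ->|-> //]; case: unliftP => [k ->|->].
have := cg2; rewrite gE => /snoc_cliff[/snoc_cliff[cv aa av] bb bav].
have ba : anti b a by have := bav ord_max; rewrite snoc_max.
have bv j : anti b (v j) by have := bav (lift ord_max j); rewrite snoc_lift.
(* An opaque stand-in for [block_mx], used only through the equations below. *)
pose bl (x y z t : 'M[C^o]_N) : 'M[C^o]_(N + N) := block_mx x y z t.
have blM x y z t x' y' z' t' : bl x y z t * bl x' y' z' t' =
    bl (x * x' + y * z') (x * y' + y * t') (z * x' + t * z') (z * y' + t * t').
  exact: block_mxM.
have blZ k x y z t : k • bl x y z t = bl (k • x) (k • y) (k • z) (k • t).
  exact: block_mxZ.
have blN x y z t : - bl x y z t = bl (- x) (- y) (- z) (- t).
  exact: opp_block_mx.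
have blD x y z t x' y' z' t' : bl x y z t + bl x' y' z' t' =
    bl (x + x') (y + y') (z + z') (t + t').
  exact: add_block_mx.
have bl1 : bl 1 0 0 1 = 1 by exact: block_mx1.
have blE x y z t : block_mx x y z t = bl x y z t by [].
clearbody bl.
(* The scalar matrix $i$, for the off-diagonal blocks of the second Pauli matrix. *)
pose J : 'M[C^o]_N := 'i%C • 1.
have JE : J = 'i%C • 1 by [].
have J2 : J * J = -1 by rewrite JE uscaleMM mulr1 i_sq uscaleNr uscale1.
have JC x : J * x = x * J by rewrite JE uscale_comm.
clearbody J.
(* The third Pauli matrix tensored with [x]. *)
pose S x := bl x 0 0 (- x).
have [w [wE wC]] : exists w, (forall j, phi (g1 j) = w j) /\ cliff w.
  exists (fun j => phi (g1 j)); split=> //; split=> [j|j k jk].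
    by rewrite -(rmorphM phi) cc (rmorph1 phi).
  by rewrite /anti -!(rmorphM phi) ca // (rmorphN phi).
case: wC => w1 wa.
have cS : cliff (snoc (snoc (S \o w) (bl 0 1 1 0)) (bl 0 (- J) J 0)).
  apply: cliff_snoc => [||j].
  - apply: cliff_snoc => [||j].
    + split=> [j|j k jk]; rewrite /anti /S /comp.
        by rewrite blM !simp w1.
      by rewrite !blM blN !simp wa.
    + by rewrite blM !simp.
    by rewrite /anti /S /= !blM blN !simp.
  - by rewrite blM !simp J2 opprK.
  - rewrite /snoc; case: unliftP => [k _|_]; rewrite /anti /S /= !blM blN !simp //.
    congr bl; exact: JC.
have [f fE] := lift2 _ _ cS.
have fa : f a = bl 0 1 1 0.
  by have := fE (lift ord_max ord_max); rewrite gE !snoc_lift !snoc_max.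
have fb : f b = bl 0 (- J) J 0 by have := fE ord_max; rewrite gE !snoc_max.
have fv j : f (v j) = S (w j).
  by have := fE (lift ord_max (lift ord_max j)); rewrite gE !snoc_lift.
(* The coefficient $-i$ makes [c] square to 1 and map to the third Pauli matrix. *)
pose c := - ('i%C • (a * b)).
have abC j : v j * (a * b) = a * b * v j.
  exact: anti_mul_comm (antiC (av j)) (antiC (bv j)).
have abab : a * b * (a * b) = -1.
  by rewrite mulrA -(mulrA a) ba mulrN mulrA aa mul1r mulNr bb.
have c2 : c * c = 1.
  by rewrite /c mulrNN uscaleMM i_sq abab uscaleNr uscale1 opprK.
have cv' j : c * v j = v j * c.
  by rewrite /c mulNr mulrN -uscaleAl -abC uscaleAr.
have ac : anti c a.
  rewrite /anti /c mulNr mulrN -uscaleAl -uscaleAr -mulrA ba mulrN mulrA.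
  by rewrite uscalerN.
have fc : f c = bl 1 0 0 (-1).
  rewrite /c rmorphN /= uhomZ rmorphM /= fa fb.
  rewrite blM !simp blZ blN JE !uscalerN uscale0 uscaleA i_sq uscaleNr uscale1.
  by rewrite !simp.
have cE : c = - ('i%C • (a * b)) by [].
clearbody c.
(* As [c] commutes with the [v j] and squares to 1, the [c * v j] again satisfy the Clifford
   relations; unlike the [v j], they commute with [a]. *)
have [|iota iotaE] := lift1 _ (fun j => c * v j).
  split=> [j|j k jk].
    by rewrite {1}cv' mulrA -(mulrA (v j)) c2 mulr1; have [] := cv.
  rewrite /anti {1}(cv' j) {2}(cv' k) !mulrA -!(mulrA _ c c) c2 !mulr1.
  by have [_] := cv; apply.
pose u : {uhom 'M[C^o]_N -> T2} := iota \o psi.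
have [D DE] := @mx_block_diag_hom C N.
(* The factors of the third Pauli matrix in [f c] and [f (v j)] cancel, which leaves a block
   diagonal image. *)
have fiota x : f (iota x) = D (phi x).
  apply: (uhom_ext (f := f \o iota) (g := D \o phi) gen1) => j.
  by rewrite /= iotaE DE rmorphM /= fv fc wE blE /S blM !simp.
have iotaC y : (forall j, c * v j * y = y * (c * v j)) ->
    forall x, y * iota x = iota x * y.
  move=> cy x; apply/esym; move: x.
  apply: (gen1 _ (subalg_preim iota (subalg_comm y))) => j.
  by rewrite /= iotaE.
have uc x : c * u x = u x * c.
  by apply: iotaC => j; rewrite -mulrA -cv'.
have ua x : a * u x = u x * a.
  apply: iotaC => j; rewrite [RHS]mulrA (antiC ac).
  by rewrite mulNr -!mulrA av mulrN opprK.
(* The spectral idempotents of [c], exchanged by [a]; in [mx_block_hom], [a] plays the part of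
   [s]. *)
pose p := 2^-1 • (1 + c); pose q := 2^-1 • (1 - c).
have pq : p + q = 1.
  by rewrite /p /q -uscaleDr addrACA subrr addr0 -mulr2n half_double.
have pp : p * p = p.
  rewrite /p -uscaleAl -uscaleAr mulrDl mul1r mulrDr mulr1 c2 (addrC c).
  by rewrite -mulr2n half_double.
have ap : a * p = q * a.
  by rewrite /p /q -uscaleAl -uscaleAr mulrDl mulrDr mul1r mulr1 mulNr (antiC ac).
have pu x : p * u x = u x * p.
  by rewrite /p -uscaleAl -uscaleAr mulrDl mulrDr mul1r mulr1 uc.
have [g gB] := mx_block_hom pq pp aa ap pu ua.
have pmq : p - q = c.
  by rewrite /p /q -uscaleB opprB addrC addrA subrK -mulr2n half_double.
exists f; exists g => [x|M].
  have [h hE] := uhom_id T2.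
  rewrite -[RHS]hE -[LHS]/((g \o f) x); move: x.
  apply: (uhom_ext gen2) => j.
  rewrite hE /= fE gE /snoc; case: unliftP => [k _|_]; last first.
    (* For the generator [b], the blocks give $-i(p-q)a=-ica$, which is [b]. *)
    rewrite -blE gB !rmorph0 !mul0r addr0 add0r rmorphN /= JE !uhomZ !rmorph1 mulNr.
    rewrite -!uscaleE addrC -uscaleB -mulrBl -(opprB p) pmq mulNr.
    have -> : c * a = 'i%C • b.
      by rewrite cE mulNr -uscaleAl -mulrA ba mulrN mulrA aa mul1r uscalerN opprK.
    by rewrite uscalerN uscaleA i_sq uscaleNr uscale1 opprK.
  case: unliftP => [k' _|_]; last first.
    by rewrite -blE gB !rmorph0 !rmorph1 !mul0r !mul1r addr0 add0r -mulrDl pq mul1r.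
  rewrite /= /S -blE gB !rmorph0 !mul0r addr0 add0r rmorphN mulNr -mulrBr pmq.
  rewrite /u /= -wE phiK iotaE.
  by rewrite cv' -mulrA c2 mulr1.
(* For the other composite: [f p] and [f q] are the diagonal block units and [f \o u] is block
   diagonal, so each block returns to its place. *)
have fp : f p = bl 1 0 0 0.
  rewrite /p uhomZ rmorphD rmorph1 /= fc -bl1 blD blZ.
  by rewrite !addr0 subrr -mulr2n half_double uscale0.
have fq : f q = bl 0 0 0 1.
  rewrite /q uhomZ rmorphB rmorph1 /= fc -bl1 blN blD blZ.
  by rewrite !simp subrr -mulr2n half_double uscale0.
rewrite -[M]submxK gB !rmorphD !rmorphM /= !fiota !psiK !DE fa fp fq.
by rewrite !blE !blM !simp !blD !simp.
Qed.

Theorem clifford_mx n N (T : uAlgType C) (g : 'I_n.*2 -> T) :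
  is_clifford g -> N = (2 ^ n)%N ->
  exists f : {uhom T -> 'M[C^o]_N}, bijective f.
Proof.
elim: n N T g => [|n IH] N T g gc ->; first exact: clifford0_mx gc.
have [phi phi_bij] := IH _ _ _ (clifford_is_clifford _) erefl.
rewrite expnS mul2n -addnn.
exact: cliffordSS_mx (clifford_is_clifford _) gc phi_bij.
Qed.
End Clifford.

(** * Twisting by the chirality element *)

Section Twist.
Context (R : realType).
Local Notation C := R[i].

(** One index set serves both families: [None] stands for $\Lambda$ in one and for the scalar
    $\lambda$ in the other. *)
Definition A_gens n (B : uAlgType C) (s : option ('I_n.*2.+1 + bool) -> B) :=
  forall u v, A_rel (fun j => s (Some (inl j))) (s (Some (inr true)))
    (s (Some (inr false))) (s None) u v -> u = v.

Definition A_tuple n (B : Type) (w : 'I_n.*2.+1 -> B) (Ep Em l : B)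
    (x : option ('I_n.*2.+1 + bool)) : B :=
  match x with
  | None => l
  | Some (inl j) => w j
  | Some (inr b) => if b then Ep else Em
  end.

Lemma A_gensP n (B : uAlgType C) (s : option ('I_n.*2.+1 + bool) -> B) :
  let w j := s (Some (inl j)) in
  let E b := s (Some (inr b)) in
  A_gens s <-> [/\ cliff w, forall b j, anti (E b) (w j) &
    E true * E false - E false * E true =
    - (4%:R^-1 • 1) + ('i%C ^+ n) • (s None * \prod_j w j)].
Proof.
move=> w E; split=> [sA|[/cliffP ww wE EE] _ _ [|j k|j|j]] //; last 3 first.
- exact: ww.
- exact: wE.
- exact: wE.
split=> [|[] j|].
- by apply/cliffP => j k; apply: sA; constructor.
- by apply: sA; constructor.
- by apply: sA; constructor.
- by apply: sA; constructor.
Qed.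

Lemma cliff_hom m (A B : uAlgType C) (f : {uhom A -> B}) (v : 'I_m -> A) :
  cliff v -> cliff (f \o v).
Proof.
case=> vv va; split=> [j|j k jk] /=; first by rewrite -rmorphM vv rmorph1.
by rewrite /anti -!rmorphM va // rmorphN.
Qed.

Lemma A_gens_hom n (A B : uAlgType C) (f : {uhom A -> B})
    (s : option ('I_n.*2.+1 + bool) -> A) : A_gens s -> A_gens (f \o s).
Proof.
move=> /A_gensP[cw Ew EE]; apply/A_gensP; split=> [|b j|] /=.
- exact: (cliff_hom f cw).
- by rewrite /anti -!rmorphM Ew rmorphN.
rewrite -!rmorphM -rmorphB EE rmorphD rmorphN /= !uhomZ rmorph1 rmorphM /=.
by rewrite rmorph_prod.
Qed.

(** The chirality element, called $G$ above; the factor $i^n$ normalizes its square to 1. *)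
Definition chir n (B : uAlgType C) (v : 'I_n.*2 -> B) : B :=
  ('i%C ^+ n) • \prod_j v j.

Lemma uhom_chir n (A B : uAlgType C) (f : {uhom A -> B}) (v : 'I_n.*2 -> A)
    (v' : 'I_n.*2 -> B) :
  (forall j, f (v j) = v' j) -> f (chir v) = chir v'.
Proof.
move=> fv; rewrite /chir uhomZ rmorph_prod; congr (_ • _).
by apply: eq_bigr => j _; exact: fv.
Qed.

Section Chir.
Context (n : nat) (B : uAlgType C) (v : 'I_n.*2 -> B).
Context (cv : cliff v).
Local Notation G := (chir v).

Lemma chir_sq : G * G = 1.
Proof.
rewrite /chir uscaleMM cliff_prod_sq // -exprMn_comm; last exact: mulrC.
rewrite i_sq -(signr_odd C n) -(signr_odd B n).
by case: (odd n); rewrite ?expr1 ?expr0 ?uscaleNr ?uscale1 ?opprK.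
Qed.

Lemma chir_anti j : anti G (v j).
Proof.
rewrite /anti /chir -uscaleAl cliff_prod_anti //.
by rewrite -uscaleAr uscalerN.
Qed.

Lemma chir_anti_comm x : (forall j, anti x (v j)) -> x * G = G * x.
Proof. by move=> xv; rewrite /chir -uscaleAr -uscaleAl anti_prod_comm. Qed.

Lemma chir_comm x : (forall j, x * v j = v j * x) -> x * G = G * x.
Proof.
move=> xv; rewrite /chir -uscaleAr -uscaleAl; congr (_ • _).
apply: (big_ind (fun y => x * y = y * x)) => [|y z xy xz|j _ //].
  by rewrite mulr1 mul1r.
by rewrite mulrA xy -mulrA xz mulrA.
Qed.

Lemma chirMM x y : x * G = G * x -> (G * x) * (G * y) = x * y.
Proof. by move=> xG; rewrite mulrA -(mulrA G) xG mulrA chir_sq mul1r. Qed.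

Lemma chirK x : G * (G * x) = x.
Proof. by rewrite mulrA chir_sq mul1r. Qed.

(** [z], [Ep] and [Em] pass the even product [G] without sign, so a product of two twisted elements
    equals the untwisted product, and the commutator is unchanged. Its right-hand side takes the
    level 0 form because $i^n$ times the full product is [G * z]. *)
Lemma chir_untwist z Ep Em l :
  A_gens (A_tuple (snoc v z) Ep Em l) ->
  A_gens (A_tuple (n := 0) (fun=> G * z) (G * Ep) (G * Em) l) /\
  (forall j x, x \in [:: z; Ep; Em] -> G * x * v j = v j * (G * x)).
Proof.
move=> /A_gensP /= [/snoc_cliff[_ zz zv] Ev EE].
have zC := chir_anti_comm zv.
have Evv b j : anti (if b then Ep else Em) (v j).
  by have := Ev b (lift ord_max j); rewrite snoc_lift.
have Ez b : anti (if b then Ep else Em) z.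
  by have := Ev b ord_max; rewrite snoc_max.
have EC b := chir_anti_comm (Evv b).
split; last first.
  have com x j : anti x (v j) -> G * x * v j = v j * (G * x).
    by move=> xv; rewrite -mulrA xv mulrN mulrA chir_anti mulNr opprK mulrA.
  move=> j x; rewrite !inE => /or3P[]/eqP->; apply: com.
  - exact: zv.
  - exact: (Evv true).
  - exact: (Evv false).
apply/A_gensP; split=> /= [|b j|].
- by split=> [_|j k]; [rewrite chirMM | rewrite !ord1 eqxx].
- have -> : (if b then G * Ep else G * Em) = G * (if b then Ep else Em) by case: b.
  by rewrite /anti (chirMM _ (EC b)) (chirMM _ zC); exact: Ez.
have ECp : Ep * G = G * Ep := EC true; have ECm : Em * G = G * Em := EC false.
rewrite (chirMM _ ECp) (chirMM _ ECm) EE prod_snoc.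
rewrite big_ord_recr big_ord0 /= mul1r expr0 uscale1; congr (_ + _).
by rewrite /chir -uscaleAl -uscaleAr.
Qed.

(** The reverse passage: multiplication by [G] turns commutation with the [v j] into
    anticommutation, and the level $n$ product collapses by $G^2=1$. *)
Lemma chir_twist w0 ep em l :
  A_gens (A_tuple (n := 0) w0 ep em l) ->
  (forall j x, x \in [:: w0 ord0; ep; em] -> x * v j = v j * x) ->
  A_gens (A_tuple (snoc v (G * w0 ord0)) (G * ep) (G * em) l).
Proof.
move=> /A_gensP /= [[ww _] Ew EE] xC.
have xG x : x \in [:: w0 ord0; ep; em] -> x * G = G * x.
  by move=> xs; apply: chir_comm => j; exact: xC.
have Gx_anti x j : x \in [:: w0 ord0; ep; em] -> anti (G * x) (v j).
  by move=> xs; rewrite /anti -mulrA xC // mulrA chir_anti mulNr mulrA.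
have w_in : w0 ord0 \in [:: w0 ord0; ep; em] by rewrite !inE eqxx.
have E_in b : (if b then ep else em) \in [:: w0 ord0; ep; em].
  by case: b; rewrite !inE eqxx ?orbT.
apply/A_gensP; split=> /= [|b j|].
- apply: cliff_snoc => // [|j]; last exact: Gx_anti.
  by rewrite chirMM ?ww ?xG.
- have -> : (if b then G * ep else G * em) = G * (if b then ep else em) by case: b.
  rewrite /snoc; case: unliftP => [k _|_]; first exact: Gx_anti.
  by rewrite /anti !chirMM ?xG //; exact: Ew.
rewrite (chirMM _ (xG ep (E_in true))) (chirMM _ (xG em (E_in false))) EE prod_snoc.
rewrite big_ord_recr big_ord0 /= mul1r expr0 uscale1; congr (_ + _).
(* The only index of [w0] appears as [ord_max] on one side and as [ord0] on the other. *)
rewrite uscaleAr uscaleAl -/(chir v) chirK; congr (_ * w0 _); exact: val_inj.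
Qed.
End Chir.

(** * Comparison with the tensor product through universal properties *)

Section Universal.
Context (P : forall B : uAlgType C, B -> Prop).
Context (P_tinr : forall (A B : uAlgType C) (l : B), P l -> P (tinr A l)).
Context (P_central : forall (B : uAlgType C) (l : B),
  P l -> forall x, l * x = x * l).

(* [P l] is the condition on the last generator: being the scalar lambda in the
   case of A_lambda, being central in the case of A_Lambda. *)
Definition is_A n (T : uAlgType C) (s : option ('I_n.*2.+1 + bool) -> T) :=
  [/\ A_gens s, P (s None), generates s &
      forall (B : uAlgType C) (s' : option ('I_n.*2.+1 + bool) -> B),
        A_gens s' -> P (s' None) ->
        exists f : {uhom T -> B}, forall x, f (s x) = s' x].

(** Each direction is a lift: [h] combines the Clifford generators with the untwisted elements, and
    [f] twists the right factor by the chirality element of the left one. They are inverse since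
    $G(Gx)=x$. *)
Lemma is_A_tensor n (T T0 D : uAlgType C) s s0 (g : 'I_n.*2 -> D) :
  @is_A n T s -> @is_A 0 T0 s0 -> is_clifford g -> T ≃ (D ⊗ T0).
Proof.
move=> [sA Ps gs lifts] [s0A Ps0 gs0 lifts0] [cg gg liftg].
have [v [z [Ep [Em [l sE]]]]] : exists v z Ep Em l,
    s = A_tuple (n := n) (snoc v z) Ep Em l.
  exists (fun j => s (Some (inl (lift ord_max j)))), (s (Some (inl ord_max))).
  exists (s (Some (inr true))), (s (Some (inr false))), (s None).
  apply/funext => -[[j|[]]|] //=.
  by rewrite /snoc; case: unliftP => [k|] ->.
have [w0 [ep [em [l0 s0E]]]] : exists w0 ep em l0,
    s0 = A_tuple (n := 0) w0 ep em l0.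
  exists (fun j => s0 (Some (inl j))), (s0 (Some (inr true))).
  exists (s0 (Some (inr false))), (s0 None).
  by apply/funext => -[[j|[]]|].
subst s s0.
have [/snoc_cliff[cv _ _] _ _] := (A_gensP _).1 sA.
have [untw untwC] := chir_untwist cv sA.
have [p pE] := liftg _ _ cv.
have [q qE] := lifts0 _ _ untw Ps.
have qw j : q (w0 j) = chir v * z by exact: (qE (Some (inl j))).
have qp : q ep = chir v * Ep by exact: (qE (Some (inr true))).
have qm : q em = chir v * Em by exact: (qE (Some (inr false))).
have ql : q l0 = l by exact: (qE None).
(* On generators: the untwisted elements commute with the [v j], and [l] is central. *)
have pqC x y : p x * q y = q y * p x.
  apply: (uhom_comm gg gs0) => j x'; rewrite pE; apply/esym.
  case: x' => [[k|[]]|] /=; rewrite ?qw ?qp ?qm ?ql.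
  - by apply: untwC; rewrite inE eqxx.
  - by apply: untwC; rewrite !inE eqxx orbT.
  - by apply: untwC; rewrite !inE eqxx !orbT.
  - exact: (P_central Ps).
have [h hE] := tensor_lift pqC.
have hl x : h (tinl T0 x) = p x by rewrite hE rmorph1 mulr1.
have hr y : h (tinr D y) = q y by rewrite hE rmorph1 mul1r.
have cg' := cliff_hom (tinl T0) cg.
have s0A' : A_gens (A_tuple (n := 0) (fun j => tinr D (w0 j)) (tinr D ep)
    (tinr D em) (tinr D l0)).
  have := A_gens_hom (f := @tinr _ D T0) s0A; congr A_gens.
  by apply/funext => -[[j|[]]|].
have [|f fE] := lifts _ _ (chir_twist cg' s0A' _) (P_tinr D Ps0).
  move=> j x; rewrite !inE => /or3P[]/eqP->; exact/esym/tinC.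
have fv j : f (v j) = tinl T0 (g j).
  by have := fE (Some (inl (lift ord_max j))); rewrite /= !snoc_lift.
have fz : f z = chir (tinl T0 \o g) * tinr D (w0 ord0).
  by have := fE (Some (inl ord_max)); rewrite /= !snoc_max.
have fp : f Ep = chir (tinl T0 \o g) * tinr D ep by exact: (fE (Some (inr true))).
have fm : f Em = chir (tinl T0 \o g) * tinr D em by exact: (fE (Some (inr false))).
have fl : f l = tinr D l0 by exact: (fE None).
(* [h] and [f] match the two chirality elements, so the twists cancel by [chirK]. *)
have hG : h (chir (tinl T0 \o g)) = chir v.
  by apply: uhom_chir => j; rewrite /= hl pE.
have fG : f (chir v) = chir (tinl T0 \o g) by exact: uhom_chir.
apply: (@alg_isoP _ _ _ f h) => x.
  have [i iE] := uhom_id T.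
  rewrite -[RHS]iE -[LHS]/((h \o f) x); move: x.
  apply: (uhom_ext gs) => x; rewrite iE /=.
  case: x => [[j|[]]|] /=.
  - rewrite /snoc; case: unliftP => [k _|_]; first by rewrite fv hl pE.
    by rewrite fz rmorphM /= hG hr qw chirK.
  - by rewrite fp rmorphM /= hG hr qp chirK.
  - by rewrite fm rmorphM /= hG hr qm chirK.
  - by rewrite fl hr ql.
have [i iE] := uhom_id (D ⊗ T0).
rewrite -[RHS]iE -[LHS]/((f \o h) x); move: x.
apply: (uhom_ext (tensor_generates gg gs0)) => -[j|x]; rewrite iE /=.
  by rewrite hl pE fv.
rewrite hr; case: x => [[j|[]]|] /=.
- by rewrite qw rmorphM /= fG fz chirK // (ord1 j).
- by rewrite qp rmorphM /= fG fp chirK.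
- by rewrite qm rmorphM /= fG fm chirK.
- by rewrite ql fl.
Qed.
End Universal.
End Twist.

(** * Universal properties of the presented algebras *)

Section Presentations.
Context (R : realType).
Local Notation C := R[i].

(** Translates relations between words of a free algebra into identities between their images. *)
Lemma A_gens_comp n (F B : uAlgType C) (h : {uhom F -> B})
    (s : option ('I_n.*2.+1 + bool) -> F) :
  (forall u v, A_rel (fun j => s (Some (inl j))) (s (Some (inr true)))
    (s (Some (inr false))) (s None) u v -> h u = h v) <-> A_gens (h \o s).
Proof.
have hEE x y : h (x * y - y * x) = h x * h y - h y * h x.
  by rewrite rmorphB !rmorphM.
have hrhs (w : 'I_n.*2.+1 -> F) l :
    h (- (4%:R^-1 • 1) + ('i%C ^+ n) • (l * \prod_j w j)) =
    - (4%:R^-1 • 1) + ('i%C ^+ n) • (h l * \prod_j h (w j)).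
  by rewrite rmorphD rmorphN /= !uhomZ rmorph1 rmorphM /= rmorph_prod.
have hN x y : h (- (x * y)) = - (h x * h y) by rewrite rmorphN rmorphM.
pose w j := s (Some (inl j)); pose E b := s (Some (inr b)).
split=> [hA u v|hA u v].
  case=> [|j k|j|j] /=.
  - by rewrite -hEE -hrhs; apply: hA; exact: (A_rel_EE w).
  - by rewrite -uhom_anticomm -(uhom_nat2 h); apply: hA; exact: (A_rel_ww w).
  - by rewrite -hN -rmorphM; apply: hA; exact: (A_rel_Epw w (E true)).
  - by rewrite -hN -rmorphM; apply: hA; exact: (A_rel_Emw w _ (E false)).
case=> [|j k|j|j].
- by rewrite hEE hrhs; apply: hA; exact: (A_rel_EE (h \o w)).
- by rewrite uhom_anticomm uhom_nat2; apply: hA; exact: (A_rel_ww (h \o w)).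
- by rewrite hN rmorphM; apply: hA; exact: (A_rel_Epw (h \o w) (h (E true))).
- by rewrite hN rmorphM; apply: hA; exact: (A_rel_Emw (h \o w) _ (h (E false))).
Qed.

(** The scalar is added as a redundant generator at [None], to share the index set of [A_Lambda]. *)
Definition A_lambda_gen (lambda : C) n (x : option ('I_n.*2.+1 + bool)) :
  A_lambda lambda n := if x is Some y then pgen _ y else lambda • 1.

Lemma A_lambda_is_A (lambda : C) n :
  is_A (fun (B : uAlgType C) (l : B) => l = lambda • 1) (@A_lambda_gen lambda n).
Proof.
pose sF (x : option ('I_n.*2.+1 + bool)) : freeAlg C ('I_n.*2.+1 + bool)%type :=
  if x is Some y then fgen y else lambda • 1.
split=> // [|P PS Pg|B s' sA' s'N].
- have [h [hg hr]] :
      exists h : {uhom freeAlg C ('I_n.*2.+1 + bool)%type -> A_lambda lambda n},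
      (forall i, h (fgen i) = A_lambda_gen lambda (Some i)) /\
      (forall u v, A_lambda_rel lambda u v -> h u = h v).
    exact: presAlg_hom.
  have /A_gens_comp : forall u v, A_rel (fun j => sF (Some (inl j)))
    (sF (Some (inr true))) (sF (Some (inr false))) (sF None) u v -> h u = h v := hr.
  congr A_gens; apply/funext => -[y|] /=; first exact: hg.
  by rewrite uhomZ rmorph1.
- by apply: pgen_generates => // y; exact: (Pg (Some y)).
have [f|f fE] := @presAlg_lift _ _ (@A_lambda_rel R lambda n) B (s' \o some).
  move=> fs; apply/(A_gens_comp f sF).2.
  move: sA'; congr A_gens; apply/funext => -[y|] /=; first by rewrite fs.
  by rewrite uhomZ rmorph1.
exists f => -[y|] /=; first exact: fE.
by rewrite uhomZ rmorph1.
Qed.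

Lemma A_Lambda_is_A n :
  is_A (fun (B : uAlgType C) (l : B) => forall x, l * x = x * l)
    (pgen (@A_Lambda_rel R n) : _ -> A_Lambda R n).
Proof.
pose F := freeAlg C (option ('I_n.*2.+1 + bool)).
have [h [hg hr]] : exists h : {uhom F -> A_Lambda R n},
    (forall i, h (fgen i) = pgen (@A_Lambda_rel R n) i) /\
    (forall u v, A_Lambda_rel u v -> h u = h v).
  exact: presAlg_hom.
have hgen : generates (pgen (@A_Lambda_rel R n) : _ -> A_Lambda R n).
  exact: pgen_generates.
split=> [|x||B s' sA' s'N].
- have /A_gens_comp : forall u v, A_rel (fun j => fgen (Some (inl j)) : F)
    (fgen (Some (inr true))) (fgen (Some (inr false))) (fgen None) u v -> h u = h v.
    by move=> u v uv; apply: hr; constructor.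
  by congr A_gens; apply/funext => y; exact: hg.
(* The centralizer of $\Lambda$ is a subalgebra, so the central relation is needed only at
   generators. *)
- apply/esym; move: x; apply: (hgen _ (subalg_comm _)) => i.
  rewrite -!hg.
  have hM := rmorphM h; rewrite -!hM; apply/esym/hr; exact: A_Lambda_rel_central.
- exact: hgen.
have [f fs u v|f fE] := @presAlg_lift _ _ (@A_Lambda_rel R n) B s'; last first.
  by exists f.
case=> [{}u {}v uv|x].
  apply: (A_gens_comp f fgen).2 uv.
  by move: sA'; congr A_gens; apply/funext => y /=; rewrite fs.
(* The central relation ranges over all [x] of the free algebra; centrality of [s' None] in [B] is
   applied to [f x]. *)
have fN : f (fgen None) = s' None := fs None.
have fM y z : f (y * z) = f y * f z by exact: rmorphM.
have fC y : f (fgen None) * y = y * f (fgen None) by rewrite fN; exact: s'N.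
exact: etrans (fM _ _) (etrans (fC _) (esym (fM _ _))).
Qed.
End Presentations.

Theorem mainTheorem6 (R : realType) (n : nat) (lambda : R[i]) :
  [/\ A_Lambda R n ≃ (clifford R n.*2 ⊗ A_Lambda R 0),
      (clifford R n.*2 ⊗ A_Lambda R 0) ≃ 'M[A_Lambda R 0]_(2 ^ n),
      A_lambda lambda n ≃ (clifford R n.*2 ⊗ A_lambda lambda 0)
    & (clifford R n.*2 ⊗ A_lambda lambda 0) ≃ 'M[A_lambda lambda 0]_(2 ^ n)].
Proof.
have cl := clifford_is_clifford R n.*2.
have [phi phi_bij] := clifford_mx cl erefl.
split; [|exact: tensor_mx_iso phi_bij| |exact: tensor_mx_iso phi_bij].
- apply: (is_A_tensor _ _ (A_Lambda_is_A R n) (A_Lambda_is_A R 0) cl); last first.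
    by move=> B l lC; exact: lC.
  (* Elements of the two factors generate the tensor product: those of [A] commute with [tinr A l]
     by [tinC], those of [B] because [l] is central in [B]. *)
  move=> A B l lC x; apply/esym; move: x.
  apply: (tensor_generates (@generates_id _ A) (@generates_id _ B)
    (subalg_comm (tinr A l))).
  by move=> [a|b]; [exact: tinC | rewrite -!rmorphM lC].
- apply: (is_A_tensor _ _ (A_lambda_is_A lambda n) (A_lambda_is_A lambda 0) cl).
    by move=> A B l ->; rewrite uhomZ rmorph1.
  by move=> B l -> x; exact: uscale_comm.
Qed.
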